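(* Let $(X,X^+)$ be an ordered Banach space and suppose that the cone $X^+$ is normal and has non-empty interior. Let $A: X \supseteq \operatorname{dom}(A) \to X$ be a densely defined and resolvent positive linear operator. Then $A$ generates a positive $C_0$-semigroup $(e^{tA})_{t \ge 0}$ on $X$, and the following assertions are equivalent: (i) The spectral bound of $A$ satisfies $s(A) < 0$. (ii) For each non-zero $0 \le x' \in \operatorname{dom}(A')$ one has $A'x' \not\ge 0$. (iii) For every interior point $z$ of $X^+$ there is a number $\eta > 0$ such that $Ax \not\ge -\eta\|x\| z$ for all non-zero $x \in \operatorname{dom}(A)^+$. (iv) There exists an interior point $z$ of $X^+$ and a number $\eta > 0$ such that $Ax \not\ge -\eta\|x\| z$ for all non-zero $x \in \operatorname{dom}(A)^+$. (v) There exists an interior point $z$ of $X^+$ belonging to $\operatorname{dom}(A)$ such that $Az \ll 0$. (vi) There exists an interior point $z$ of $X^+$ belonging to $\operatorname{dom}(A)$ and a number $\lambda < 0$ such that $Az \le \lambda z$. (vii) For each $x \in X$ one has $e^{tA}x \to 0$ as $t \to \infty$. (viii) For each $x \in X^+$ one has $\inf_{t \ge 0}\|e^{tA}x\| = 0$. (ix) The growth bound of the semigroup $(e^{tA})_{t\ge 0}$ satisfies $\omega(A) < 0$.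
   Context: An ordered Banach space $(X,X^+)$ is a real Banach space $X$ together with a closed convex cone $X^+$ (so $X^+ + X^+ \subseteq X^+$ and $[0,\infty)X^+ \subseteq X^+$) with $X^+ \cap (-X^+) = \{0\}$; $x \le y$ means $y-x \in X^+$. The cone is normal if there is $C>0$ with $\|x\| \le C\|y\|$ whenever $0 \le x \le y$. Interior means interior in the norm topology. For $x,y\in X$, $x \ll y$ means that there is an interior point $z$ of $X^+$ with $x + z \le y$. A bounded linear operator $T$ on $X$ is positive if $TX^+ \subseteq X^+$; a $C_0$-semigroup is positive if each of its operators is positive. Spectral notions for a closed operator on $X$ (spectrum $\sigma(A)$, resolvent set $\rho(A)$, resolvent $\mathcal{R}(\lambda,A) = (\lambda-A)^{-1}$) refer to the canonical extension of $A$ to a complexification of $X$. A linear operator $A$ is resolvent positive if there is $\omega\in\mathbb{R}$ such that $(\omega,\infty) \subseteq \rho(A)$ and $\mathcal{R}(\lambda,A)$ is positive for each $\lambda \in (\omega,\infty)$. The spectral bound is $s(A) := \sup\{\operatorname{Re}\lambda: \lambda\in\sigma(A)\} \in [-\infty,\infty]$ with $\sup\emptyset=-\infty$. The growth bound is $\omega(A) := \inf\{\omega\in\mathbb{R} : \exists M \ge 1\ \forall t \ge 0\ \|e^{tA}\| \le M e^{t\omega}\} \in [-\infty,\infty)$. $\operatorname{dom}(A)^+ := \operatorname{dom}(A)\cap X^+$. $A'$ is the dual operator of $A$ on the dual space $X'$, which is ordered by the dual cone $(X')^+ := \{x'\in X' : \langle x',x\rangle \ge 0 \text{ for all } x\in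 X^+\}$. *)

(* Defs.v *)
From HB Require Import structures.
From mathcomp Require Export all_boot all_order all_algebra.
From mathcomp Require Import ssrAC complex.
From mathcomp Require Export all_classical all_reals all_analysis.
Export Order.TTheory GRing.Theory Num.Theory.
Export numFieldNormedType.Exports.

Set Implicit Arguments.
Unset Strict Implicit.
Unset Printing Implicit Defensive.

Local Open Scope classical_set_scope.
Local Open Scope ring_scope.

Section Cones.
Variables (R : realType).

Definition cone_le (V : zmodType) (K : set V) (x y : V) : Prop := K (y - x).

Definition closed_convex_cone (X : normedModType R) (K : set X) : Prop :=
  [/\ closed K,
      forall x y, K x -> K y -> K (x + y) &
      forall (a : R) x, 0 <= a -> K x -> K (a *: x)].

(* The last clause also makes the cone non-empty. *)
Definition ordered_banach (X : completeNormedModType R) (K : set X) : Prop :=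
  closed_convex_cone K /\ K `&` [set - x | x in K] = [set 0].

Definition normal_cone (X : normedModType R) (K : set X) : Prop :=
  exists2 c : R, 0 < c &
    forall x y, cone_le K 0 x -> cone_le K x y -> `|x| <= c * `|y|.

Definition cone_ll (X : normedModType R) (K : set X) (x y : X) : Prop :=
  exists2 z, interior K z & cone_le K (x + z) y.

Definition positive_map (V : Type) (K : set V) (S : V -> V) : Prop :=
  forall x, K x -> K (S x).

End Cones.

(* The values of [opfun] outside [dom] are irrelevant. *)
Record operator (V : Type) := Operator { dom : set V; opfun :> V -> V }.

Definition linear_operator (K : pzRingType) (V : lmodType K) (A : operator V) :
    Prop :=
  dom A 0 /\
  forall (a : K) x y, dom A x -> dom A y ->
    dom A (a *: x + y) /\ A (a *: x + y) = a *: A x + A y.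

(* The pair (x, y) stands for x + iy.  The topology is the product topology,
   which is the one induced by any complexification norm on X + iX. *)
Definition complexification (X : Type) : Type := (X * X)%type.

Section Complexification.
Variables (R : realType) (X : normedModType R).
Local Notation XC := (complexification X).

HB.instance Definition _ := PseudoMetricNormedZmod.copy XC (X * X)%type.

Definition scaleC (c : R[i]) (z : XC) : XC :=
  (complex.Re c *: z.1 - complex.Im c *: z.2,
   complex.Re c *: z.2 + complex.Im c *: z.1).

Fact scaleCA a b v : scaleC a (scaleC b v) = scaleC (a * b) v.
Proof.
case: a b v => [a1 a2] [b1 b2] [x y]; rewrite /scaleC /=.
congr pair; rewrite !(scalerBr, scalerDr, scalerBl, scalerDl) !scalerA ?opprD.
- by rewrite [LHS](AC (2*2) ((1*4)*(2*3))).
- by rewrite [LHS](AC (2*2) ((1*4)*(2*3))).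
Qed.

Fact scaleC1 : left_id 1 scaleC.
Proof. by case=> x y; rewrite /scaleC /= !scale1r !scale0r subr0 addr0. Qed.

Fact scaleCDr : right_distributive scaleC +%R.
Proof.
move=> [a b] [x y] [x' y']; rewrite /scaleC /=.
congr pair; rewrite /= !scalerDr ?opprD; exact: addrACA.
Qed.

Fact scaleCDl v : {morph scaleC^~ v : a b / a + b}.
Proof.
case: v => x y [a b] [c d]; rewrite /scaleC /=.
congr pair; rewrite /= !scalerDl ?opprD; exact: addrACA.
Qed.

HB.instance Definition _ :=
  GRing.Zmodule_isLmodule.Build R[i] XC scaleCA scaleC1 scaleCDr scaleCDl.

Definition complexify (A : operator X) : operator XC :=
  Operator [set z : XC | dom A z.1 /\ dom A z.2]
           (fun z : XC => (A z.1, A z.2) : XC).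

Definition complex_cone (K : set X) : set XC := [set z | K z.1 /\ z.2 = 0].

End Complexification.

Section Spectrum.
Variables (R : realType) (X : normedModType R).
Implicit Types (A : operator X) (K : set X) (lambda : R[i]).
Local Notation XC := (complexification X).

Definition resolvent A lambda : XC -> XC :=
  'pinv_(fun=> 0) (dom (complexify A))
    (fun z : XC => lambda *: z - complexify A z).

Definition resolvent_set A : set R[i] :=
  [set lambda |
    set_bij (dom (complexify A)) setT
      (fun z : XC => lambda *: z - complexify A z) /\
    continuous (resolvent A lambda)].

Definition spectrum A : set R[i] := ~` resolvent_set A.

(* [ereal_sup set0 = -oo]. *)
Definition spectral_bound A : \bar R :=
  ereal_sup [set (complex.Re lambda)%:E | lambda in spectrum A].

Definition resolvent_positive K A : Prop :=
  exists omega : R, forall lambda : R, omega < lambda ->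
    resolvent_set A (real_complex R lambda) /\
    positive_map (complex_cone K) (resolvent A (real_complex R lambda)).

End Spectrum.

Section Semigroups.
Variables (R : realType) (X : normedModType R).
(* Only the values [T t] with [0 <= t] matter. *)
Implicit Types (T : R -> X -> X).

Definition C0_semigroup T : Prop :=
  [/\ forall t : R, 0 <= t -> linear (T t) /\ continuous (T t),
      T 0 = id,
      forall s t : R, 0 <= s -> 0 <= t -> T (s + t) = T s \o T t &
      forall x, T t x @[t --> 0^'+] --> x].

Definition generates (A : operator X) T : Prop :=
  C0_semigroup T /\
  dom A = [set x | cvg (h^-1 *: (T h x - x) @[h --> 0^'+])] /\
  forall x, dom A x -> h^-1 *: (T h x - x) @[h --> 0^'+] --> A x.

Definition positive_semigroup (K : set X) T : Prop :=
  forall t : R, 0 <= t -> positive_map K (T t).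

Definition opnorm (S : X -> X) : \bar R :=
  ereal_sup [set (`|S x|)%:E | x in [set x : X | `|x| <= 1]].

Definition growth_bound T : \bar R :=
  ereal_inf [set omega%:E | omega in
    [set omega : R | exists2 M : R, 1 <= M &
       forall t : R, 0 <= t -> (opnorm (T t) <= (M * expR (t * omega))%:E)%E]].

End Semigroups.

Section Duality.
Variables (R : realType) (X : normedModType R).

(* The dual space as a subset of the module of all functions [X -> R]. *)
Definition dual_space : set (X -> R) :=
  [set f | linear (f : X -> R^o) /\ continuous f].

Definition dual_cone (K : set X) : set (X -> R) :=
  [set f | dual_space f /\ forall x, K x -> 0 <= f x].

Definition dual_graph (A : operator X) (f g : X -> R) : Prop :=
  [/\ dual_space f, dual_space g & forall x, dom A x -> f (A x) = g x].

(* When [dom A] is dense, [dual_graph A f] holds of at most one [g]. *)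
Definition dual_operator (A : operator X) : operator (X -> R) :=
  Operator [set f | exists g, dual_graph A f g]
           (fun f => xget 0 [set g | dual_graph A f g]).

End Duality.

(* Main.v *)
Require Import Defs.
From mathcomp Require Import ring lra ssrAC complex.

Set Implicit Arguments.
Unset Strict Implicit.
Unset Printing Implicit Defensive.

Local Open Scope classical_set_scope.
Local Open Scope ring_scope.

(** Let [z] be an interior point of the cone.  Since the cone is normal, the gauge
    [N x = inf {r >= 0 | - r z <= x <= r z}] is a norm equivalent to the given one
    ([gauge_equivalent]), and a positive operator [S] has [N]-norm at most [M] as soon
    as [S z <= M z].  So everything about [A], its resolvent and its semigroup can be
    controlled by looking at the single vector [z].  The key instance: if [z] lies in
    the domain and [A z <= c z], then positivity of the resolvent at [mu] gives
    [(mu - c) N x <= N (mu x - A x)] ([gauge_dissipative]); that is, [A - c] is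
    dissipative for [N].

    Generation.  Some [c] is always admissible, because [z] is an order unit, and the
    density of the domain provides [z].  The Lumer-Phillips theorem
    ([lumer_phillips]) then yields a contraction semigroup for [A - c].  It is proved
    by implicit Euler steps [J h = (1 - h B)^-1]: replacing a step [h] by two steps
    [h / 2] costs at most [h^2 / 4] times [N (B^2 x)], because [J a (J b x)] and
    [J (a + b) x] differ by [a b J a J b J (a + b) B^2 x] ([euler_add]), so halving the
    steps again and again converges geometrically.  The same identity gives the
    semigroup law.

    Any semigroup generated by [A] preserves the lower bounds [- r z] up to the factor
    [e^(c t)] ([orbit_lower_bound]).  This gives its positivity, and the bound
    [N (T t x) <= e^(c t) N x].  The argument follows an orbit by induction along the
    real half-line ([real_induction]); it needs orbits that are continuous from the
    left, hence the uniform boundedness principle.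

    The equivalences hinge on the assertion that [0] is a point of positive
    resolvent, [pos_resolvent K A 0].
    - The infimum [l0] of the points from which on the resolvent exists and is positive
      is the only obstacle: near [l0] the images of [z] under the resolvent must be
      unbounded ([not_pos_resolvent0]).  If [0] is not a point of positive resolvent
      then [0 <= l0].  In case (i) the point [l0] would be spectral
      ([spectral_bound_pos_resolvent]), and in case (iv) the images of [z] would violate
      the hypothesis ([not_supersolution_pos_resolvent]).
    - From [pos_resolvent K A 0] one reads off (iii) ([inverse_not_supersolution]) and,
      with [z = - A^-1 u], (v) ([inverse_unit_interior]); (vi) is a reformulation of (v).
    - From (vi), that is [A z <= c z] with [c < 0], the dissipativity estimate
      complexifies to [(Re lambda - c) N v <= N (lambda v - A v)] in a norm which is
      homogeneous for complex scalars; by continuation from large real points the whole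
      half plane [Re lambda > c] belongs to the resolvent set ([spectral_bound_le]),
      which is (i).  The bound on the semigroup gives (ix) ([growth_bound_le]), hence
      (vii) and (viii).
    - Under (viii) a positive functional [f] with [A' f >= 0] is zero, since it
      does not decrease along positive orbits ([dual_pair_vanishes]); this is (ii).
    - If (v) fails, a separation argument in [X * X] produces a functional that
      contradicts (ii) ([positive_dual_pair]). *)

(** * Convergence, density and bounded linear maps *)

Section ZmoduleIdentities.
Variable V : zmodType.
Implicit Types a b k p q t u w x y z : V.

Lemma subrACA x y z t : x - y - (z - t) = x - z - (y - t).
Proof. by rewrite !opprD !opprK addrACA. Qed.

Lemma sub_second_difference (a b x y c d : V) :
  a - x - c = (a - b - (x - y)) + (b - y - d - (c - d)).
Proof.
have -> : b - y - d - (c - d) = b - y - c by rewrite opprB addrA subrK.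
by rewrite subrACA addrA subrK.
Qed.

Lemma dominated_split x k q w : x + w - q = k + (q + (x - k)) + (w - (q + q)).
Proof.
have -> : k + (q + (x - k)) = x + q by rewrite addrCA (addrC k) subrK addrC.
by rewrite [RHS]addrA [x + q + w]addrAC opprD addrA addrK.
Qed.

Lemma supersolution_split u a b t k p w :
  - (p + w + t) = (u - a - b - t) + k + ((a - (u + (p + k))) + (b - w)).
Proof.
have -> : u - a - b - t + k = (u + k - t) - (a + b).
  by rewrite opprD addrA [LHS](ACl (1*5*4*2*3)).
rewrite (addrACA a) -opprD [RHS]addrA subrK.
have -> : u + (p + k) + w = (u + k) + (p + w) by rewrite [LHS](AC (1*2*1) ((1*3)*(2*4))).
by rewrite (opprD (u + k)) addrA [_ - t - _]addrAC subrr sub0r -opprD addrC.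
Qed.

End ZmoduleIdentities.

Section Epsilon.
Context {R : realType}.
Implicit Types (X Y : normedModType R).

Lemma dense_ball X (D : set X) (x : X) (e : R) :
  dense D -> 0 < e -> exists2 y, D y & `|x - y| < e.
Proof.
move=> dD e0.
have [||y [xy Dy]] := dD (ball x e); [by exists x; exact: ballxx|exact: ball_open|].
by exists y => //; move: xy; rewrite -ball_normE.
Qed.

Lemma interior_ball X (D : set X) (x : X) :
  interior D x -> exists2 e : R, 0 < e & forall y, `|y - x| < e -> D y.
Proof.
rewrite /interior => /nbhs_ballP[e /= e0 xD]; exists e => // y yx; apply: xD.
by rewrite -ball_normE /= distrC.
Qed.

Lemma ball_interior X (D : set X) (x : X) (e : R) :
  0 < e -> (forall y, `|y - x| < e -> D y) -> interior D x.
Proof.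
move=> e0 xD; apply/nbhs_ballP; exists e => //= y.
by rewrite -ball_normE /= distrC; exact: xD.
Qed.

Lemma cvg_rightP X (f : R -> X) (l : X) :
  f h @[h --> 0^'+] --> l <->
  forall e, 0 < e -> exists2 d, 0 < d & forall h, 0 < h -> h < d -> `|f h - l| < e.
Proof.
split=> [/cvgrPdist_lt fl e e0|fl].
- have := fl _ e0; rewrite near_withinE => /nbhs_ballP[d /= d0 fd].
  exists d => // h h0 hd; rewrite distrC; apply: fd => //.
  by rewrite -ball_normE /= sub0r normrN gtr0_norm.
- apply/cvgrPdist_lt => e e0; have [d d0 fd] := fl _ e0.
  near=> h; rewrite distrC; apply: fd; near: h; first exact: nbhs_right_gt.
  exact: nbhs_right_lt.
Unshelve. all: by end_near. Qed.

Lemma cvg_seqP X (u : nat -> X) (l : X) :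
  u n @[n --> \oo] --> l <->
  forall e : R, 0 < e -> exists N, forall n, (N <= n)%N -> `|u n - l| < e.
Proof.
split=> [/cvgrPdist_lt ul e e0|ul].
- have [N _ uN] := ul _ e0; exists N => n Nn; rewrite distrC; exact: uN.
- apply/cvgrPdist_lt => e e0; have [N uN] := ul _ e0.
  by exists N => // n /= Nn; rewrite distrC; exact: uN.
Qed.

Lemma cvg_pinftyP X (f : R -> X) (l : X) :
  f t @[t --> +oo] --> l <->
  forall e : R, 0 < e -> exists M, forall t, M < t -> `|f t - l| < e.
Proof.
split=> [/cvgrPdist_lt fl e e0|fl].
- have [M [_ fM]] := fl _ e0; exists M => t Mt; rewrite distrC; exact: fM.
- apply/cvgrPdist_lt => e e0; have [M fM] := fl _ e0.
  exists M; split; first exact: num_real.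
  by move=> t /= Mt; rewrite distrC; exact: fM.
Qed.

Lemma cvg_unique_norm X (u : nat -> X) (l l' : X) :
  u n @[n --> \oo] --> l -> u n @[n --> \oo] --> l' -> l = l'.
Proof. by move=> h h'; apply: (cvg_unique _ h h'); exact: norm_hausdorff. Qed.

Lemma half_pow_lt (C e : R) : 0 < e ->
  exists N, forall n, (N <= n)%N -> C * 2^-1 ^+ n < e.
Proof.
move=> e0.
have h2 : `|2^-1 : R| < 1 by rewrite ger0_norm // invf_lt1 ?ltr1n.
have [N hN] := (cvg_seqP (X := R^o) _ _).1 (cvg_geometric C h2) e e0.
exists N => n Nn; have := hN n Nn; rewrite subr0.
by apply: le_lt_trans; exact: ler_norm.
Qed.

Lemma geometric_increments (V : zmodType) (N : V -> R) (u : nat -> V) (C : R) :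
  N 0 = 0 -> (forall x, 0 <= N x) -> (forall x y, N (x + y) <= N x + N y) ->
  (forall n, N (u n.+1 - u n) <= C * 2^-1 ^+ n) ->
  forall n m, N (u (n + m)%N - u n) <= 2 * C * 2^-1 ^+ n.
Proof.
move=> N0 Nge0 ND uC n m.
have C0 : 0 <= C.
  by have := uC 0%N; rewrite expr0 mulr1; apply: le_trans.
have q0 k : 0 <= 2^-1 ^+ k :> R by rewrite exprn_ge0 // invr_ge0.
suff H : N (u (n + m)%N - u n) <= 2 * C * (2^-1 ^+ n - 2^-1 ^+ (n + m)).
  apply: (le_trans H); rewrite ler_wpM2l //; first by rewrite mulr_ge0.
  by rewrite gerBl.
elim: m => [|m IH]; first by rewrite addn0 !subrr N0 mulr0.
rewrite addnS -(subrKA (u (n + m)%N)) (le_trans (ND _ _)) //.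
apply: (le_trans (lerD (uC _) IH)); rewrite exprS.
set q := 2^-1 ^+ (n + m); set p := 2^-1 ^+ n.
by rewrite le_eqVlt; apply/orP; left; apply/eqP; field.
Qed.

(** Completeness for geometrically convergent sequences: in this form it passes to
    products component by component. *)
Definition geometrically_complete Y := forall (u : nat -> Y) (C : R),
  (forall n, `|u n.+1 - u n| <= C * 2^-1 ^+ n) ->
  exists l : Y, u n @[n --> \oo] --> l.

Lemma complete_geometrically (X : completeNormedModType R) :
  geometrically_complete X.
Proof.
move=> u C uC; apply/cvg_ex; apply: cauchy_cvg.
apply/cauchyP => e e0.
have [N hN] := half_pow_lt (2 * C) e0.
exists (u N); exists N => // n /= Nn; rewrite -ball_normE /= distrC.
rewrite -(subnKC Nn); apply: le_lt_trans (hN N (leqnn N)).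
exact: (geometric_increments (normr0 X) (@normr_ge0 _ X) (@ler_normD _ X) uC).
Qed.

Lemma prod_geometrically Y Z : geometrically_complete Y ->
  geometrically_complete Z -> geometrically_complete (Y * Z)%type.
Proof.
move=> cY cZ u C uC.
have nf (w : Y * Z) : `|w.1| <= `|w| /\ `|w.2| <= `|w|.
  by rewrite prod_normE !le_max !lexx orbT.
have [|a ha] := cY (fun n => (u n).1) C.
  by move=> n; apply: (le_trans _ (uC n)); exact: (nf (u n.+1 - u n)).1.
have [|b hb] := cZ (fun n => (u n).2) C.
  by move=> n; apply: (le_trans _ (uC n)); exact: (nf (u n.+1 - u n)).2.
exists (a, b).
have -> : u = fun n => ((u n).1, (u n).2) by apply/funext => n; case: (u n).
exact: cvg_pair.
Qed.

End Epsilon.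

Section BoundedMaps.
Variables (R : realType) (X Y : normedModType R) (f : X -> Y).
Hypothesis lf : linear f.

Lemma linear_map0 : f 0 = 0.
Proof. by have := lf (-1) 0 0; rewrite scaleN1r addNr scaleN1r addNr. Qed.

Lemma linear_mapZ a x : f (a *: x) = a *: f x.
Proof. by rewrite -[in LHS](addr0 (a *: x)) lf linear_map0 addr0. Qed.

Lemma linear_mapB x y : f (x - y) = f x - f y.
Proof. by rewrite -scaleN1r addrC lf scaleN1r addrC. Qed.

Lemma linear_map_scale_bound (d M : R) : 0 < d ->
  (forall x, `|x| < d -> `|f x| <= M) -> forall x, `|f x| <= 2 / d * M * `|x|.
Proof.
move=> d0 hd x; have [->|x0] := eqVneq x 0.
  by rewrite linear_map0 !normr0 mulr0.
have nx : 0 < `|x| by rewrite normr_gt0.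
pose a := d / (2 * `|x|); have a0 : 0 < a by rewrite divr_gt0 // mulr_gt0.
have : `|a *: x| < d.
  rewrite normrZ gtr0_norm // /a invfM mulrA mulfVK ?normr_eq0 //.
  by rewrite ltr_pdivrMr //; lra.
move=> /hd; rewrite linear_mapZ normrZ gtr0_norm // -ler_pdivlMl // /a invf_div.
by rewrite (_ : 2 * `|x| / d * M = 2 / d * M * `|x|) //; ring.
Qed.

Lemma continuous_linear_bound : continuous f ->
  exists2 M : R, 0 < M & forall x, `|f x| <= M * `|x|.
Proof.
move=> cf; have c0 : f x @[x --> (0 : X)] --> (0 : Y).
  by rewrite -[X in _ --> X]linear_map0; exact: cf.
have c1 : nbhs (0 : X) [set x | `|0 - f x| < 1].
  by move/cvgrPdist_lt : c0 => /(_ 1 ltr01).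
move/nbhs_ballP : c1 => [d /= d0 hd];  exists (2 / d * 1).
  by rewrite mulr1 divr_gt0.
apply: linear_map_scale_bound => // x xd; have := hd x.
by rewrite -ball_normE /= !sub0r !normrN => /(_ xd)/ltW.
Qed.


Lemma linear_bound_continuous (M : R) :
  (forall x, `|f x| <= M * `|x|) -> continuous f.
Proof.
move=> fM x; apply/cvgrPdist_lt => e e0.
have M1 : 0 < `|M| + 1 by rewrite ltr_wpDl.
apply/nbhs_ballP; exists (e / (`|M| + 1)); first by rewrite /= divr_gt0.
move=> y; rewrite -ball_normE /= ltr_pdivlMr // => xy.
rewrite -linear_mapB; apply: le_lt_trans xy; apply: (le_trans (fM _)).
by rewrite mulrC ler_wpM2l // (le_trans (ler_norm M)) // lerDl.
Qed.

End BoundedMaps.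

Section Induction.
Variable R : realType.

(** The points reached from [a] have a supremum, which is reached because [Q] is closed
    from the left, and which could be passed by a short step if it were smaller than
    [b].  Applied to bounds on increments, this does the work of an integral or of a
    mean value inequality. *)
Lemma real_induction (Q : R -> R -> Prop) (a b : R) :
  (forall s t r, Q s t -> Q t r -> Q s r) ->
  Q a a ->
  (forall t, a < t -> t <= b ->
     (forall d, 0 < d -> exists2 s, t - d < s <= t & Q a s) -> Q a t) ->
  (forall t, a <= t -> t < b ->
     exists2 d, 0 < d & forall h, 0 < h -> h < d -> Q t (t + h)) ->
  a <= b -> Q a b.
Proof.
move=> Qtrans Qaa Qclosed Qstep ab.
pose S := [set t | a <= t <= b /\ Q a t].
have Sa : S a by split=> //; rewrite lexx.
have hS : has_sup S by split; [exists a|exists b => t [/andP[]]].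
have ubS : ubound S (sup S) by exact: sup_upper_bound.
have aS : a <= sup S by exact: ubS.
have Sb : sup S <= b by apply: ge_sup; [exists a|move=> t [/andP[]]].
have QS : Q a (sup S).
  move: aS; rewrite le_eqVlt => /orP[/eqP <- //|aS].
  apply: Qclosed => // d d0.
  have [s Ss ds] := sup_adherent d0 hS.
  by exists s; [rewrite ds /=; exact: ubS|case: Ss].
move: Sb; rewrite le_eqVlt => /orP[/eqP <- //|Sb].
have [d d0 hd] := Qstep _ aS Sb.
pose h := Num.min d (b - sup S) / 2.
have m0 : 0 < Num.min d (b - sup S) by rewrite lt_min d0 subr_gt0.
have h0 : 0 < h by rewrite divr_gt0.
have hm : h < Num.min d (b - sup S) by rewrite /h ltr_pdivrMr //; lra.
have : S (sup S + h).
  split; last first.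
    apply: Qtrans QS _; apply: hd => //; apply: lt_le_trans hm _.
    by rewrite ge_min lexx.
  move: hm; rewrite lt_min => /andP[_ hb].
  by apply/andP; split; lra.
by move/ubS; lra.
Qed.

End Induction.

(** * The Hahn-Banach theorem for a sublinear functional *)
Section HahnBanach.
Variables (R : realType) (V : lmodType R).
Implicit Types (p q : V -> R) (x y : V).

Definition sublinear p :=
  (forall x y, p (x + y) <= p x + p y) /\
  (forall (a : R) x, 0 <= a -> p (a *: x) = a * p x).

Lemma sublinear0 p : sublinear p -> p 0 = 0.
Proof. by move=> [_ pZ]; rewrite -(scale0r 0) pZ // mul0r. Qed.

Lemma sublinear_ge p x : sublinear p -> - p (- x) <= p x.
Proof.
move=> sp; rewrite -subr_ge0 opprK -(sublinear0 sp) -(subrr x).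
exact: sp.1.
Qed.

Lemma sublinearP p : (forall x y, p (x + y) <= p x + p y) ->
  p 0 = 0 -> (forall (a : R) x, 0 < a -> p (a *: x) <= a * p x) -> sublinear p.
Proof.
move=> pD p0 pZ; split=> // a x; rewrite le_eqVlt => /orP[/eqP <-|a0].
  by rewrite scale0r mul0r.
apply/le_anti; rewrite pZ //= -ler_pdivlMl //.
have := pZ a^-1 (a *: x); rewrite scalerA mulVf ?gt_eqF // scale1r; apply.
by rewrite invr_gt0.
Qed.

(** The functional [q' x = inf_(t >= 0) (q (x + t y) - t q y)].  For a minimal [q] it
    equals [q], and then the last inequality says that [q] is superadditive. *)
Lemma sublinear_lower q y : sublinear q -> exists q', [/\ sublinear q',
  forall x, q' x <= q x & forall x, q' x <= q (x + y) - q y].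
Proof.
move=> sq; have [qD qZ] := sq.
pose S x := [set q (x + t *: y) - t * q y | t in [set t : R | 0 <= t]].
pose q' x := inf (S x).
have lbS x : lbound (S x) (- q (- x)).
  move=> _ [t /= t0 <-]; rewrite -qZ //.
  have := qD (- x) (x + t *: y); rewrite addKr; lra.
have q'le x t : 0 <= t -> q' x <= q (x + t *: y) - t * q y.
  by move=> t0; apply: ge_inf; [exists (- q (- x))|exists t].
have q'ge x m : (forall t, 0 <= t -> m <= q (x + t *: y) - t * q y) -> m <= q' x.
  move=> h; apply: lb_le_inf; first by exists (q (x + 0 *: y) - 0 * q y); exists 0 => /=.
  by move=> _ [t /= t0 <-]; exact: h.
exists q'; split; last 2 first.
- by move=> x; apply: le_trans (q'le x 0 _) _; rewrite // scale0r addr0 mul0r subr0.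
- by move=> x; have := q'le x 1 ler01; rewrite scale1r mul1r.
apply: sublinearP.
- move=> x1 x2; rewrite -lerBlDr; apply: (q'ge) => t1 t10.
  rewrite lerBlDr -lerBlDl; apply: (q'ge) => t2 t20.
  have := q'le (x1 + x2) (t1 + t2) (addr_ge0 t10 t20).
  by rewrite scalerDl addrACA; have := qD (x1 + t1 *: y) (x2 + t2 *: y); lra.
- apply/le_anti/andP; split.
    by have := q'le 0 0 (lexx 0); rewrite scale0r addr0 mul0r subr0 (sublinear0 sq).
  by apply: (q'ge) => t t0; rewrite add0r qZ // subrr.
- move=> a x a0; rewrite -ler_pdivrMl //; apply: (q'ge) => t t0.
  rewrite ler_pdivrMl // mulrBr mulrA -(qZ a) ?(ltW a0) // scalerDr scalerA.
  by apply: (q'le (a *: x)); rewrite mulr_ge0 // ltW.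
Qed.

(** A minimal sublinear functional is linear, and Zorn's lemma provides one below any
    given sublinear functional.  Starting below the functional obtained from [p] in the
    direction [x0], instead of [p] itself, forces the value at [x0]. *)
Theorem hahn_banach p x0 : sublinear p -> exists f : V -> R,
  [/\ linear (f : V -> R^o), forall x, f x <= p x & f x0 = p x0].
Proof.
move=> sp; have [p0 [sp0 p0p p0x]] := sublinear_lower x0 sp.
pose T := {q : V -> R | sublinear q /\ forall x, q x <= p0 x}.
pose r (s t : T) : bool := `[< forall x, sval t x <= sval s x >].
have t0 : T by exists p0.
have [||||f fmax] := @Zorn T r.
- by move=> t; apply/asboolP.
- by move=> s t u /asboolP st /asboolP tu; apply/asboolP => x; exact: le_trans (st x).
- move=> [s hs] [t ht] /asboolP st /asboolP ts; apply/eq_exist/funext => x.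
  by apply/le_anti/andP; split; [exact: ts|exact: st].
- move=> A Atot; have [[a0 Aa0]|nA] := pselect (A !=set0); last first.
    by exists t0 => s As; case: nA; exists s.
  pose S x := [set sval q x | q in A].
  have lbS x : lbound (S x) (- p0 (- x)).
    move=> _ [[q [sq qp]] Aq <-] /=; apply: le_trans (sublinear_ge _ sq).
    by rewrite lerN2.
  pose m x := inf (S x).
  have mle x (q : T) : A q -> m x <= sval q x.
    by move=> Aq; apply: ge_inf; [exists (- p0 (- x))|exists q].
  have mge x c : (forall q : T, A q -> c <= sval q x) -> c <= m x.
    move=> h; apply: lb_le_inf; first by exists (sval a0 x); exists a0.
    by move=> _ [q Aq <-]; exact: h.
  have sm : sublinear m.
    apply: sublinearP.
    (* Of two members of the chain the smaller one serves for both points. *)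
    - move=> x y; rewrite -lerBlDr; apply: (mge) => q1 Aq1.
      rewrite lerBlDr -lerBlDl; apply: (mge) => q2 Aq2; rewrite lerBlDl.
      have [/asboolP q12|/asboolP q21] := Atot _ _ Aq1 Aq2.
      + apply: le_trans (mle _ _ Aq2) _; apply: le_trans ((svalP q2).1.1 x y) _.
        by rewrite lerD2r.
      + apply: le_trans (mle _ _ Aq1) _; apply: le_trans ((svalP q1).1.1 x y) _.
        by rewrite lerD2l.
    - apply/le_anti/andP; split.
        by apply: le_trans (mle _ _ Aa0) _; rewrite (sublinear0 (svalP a0).1).
      by apply: (mge) => q Aq; rewrite (sublinear0 (svalP q).1).
    - move=> a x a0'; rewrite -ler_pdivrMl //; apply: (mge) => q Aq.
      by rewrite ler_pdivrMl // -(svalP q).1.2 ?(ltW a0') //; exact: mle.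
  have mp x : m x <= p0 x by apply: le_trans (mle _ _ Aa0) ((svalP a0).2 x).
  by exists (exist _ m (conj sm mp)) => q Aq; apply/asboolP => x; exact: mle.
have [sf fp] := svalP f; set g := sval f in sf fp.
have gadd x y : g (x + y) = g x + g y.
  apply/le_anti; rewrite sf.1 /=.
  have [q' [sq' q'g q'y]] := sublinear_lower y sf.
  have q'p x' : q' x' <= p0 x' by exact: le_trans (q'g _) (fp _).
  have := fmax (exist _ q' (conj sq' q'p)).
  have -> : r f (exist _ q' (conj sq' q'p)) by apply/asboolP.
  move=> /(_ isT)/(congr1 sval)/= q'f.
  by have := q'y x; rewrite q'f -/g lerBrDr.
have g0 : g 0 = 0 by exact: sublinear0.
have gN x : g (- x) = - g x by apply/eqP; rewrite -addr_eq0 -gadd addNr g0.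
exists g; split.
- move=> a x y; rewrite gadd; congr (_ + _); rewrite -[RHS]/(a * g x).
  have [a0|/ltW a0] := leP 0 a; first exact: sf.2.
  by rewrite -(opprK a) scaleNr gN sf.2 ?oppr_ge0 // !mulNr.
- by move=> x; apply: le_trans (fp _) (p0p _).
- apply/le_anti/andP; split; first exact: le_trans (fp _) (p0p _).
  have := le_trans (fp (- x0)) (p0x (- x0)).
  by rewrite addNr (sublinear0 sp) add0r gN lerN2.
Qed.

End HahnBanach.

(** * Equivalent norms and the gauge of an order unit *)
Section EquivalentNorm.
Variables (R : realType) (X : normedModType R).

(** A second norm is a plain function here: it will depend on the choice of an interior
    point, and the topology remains that of the given norm. *)
Definition equivalent_norm (N : X -> R) := [/\
  forall x y, N (x + y) <= N x + N y,
  forall (a : R) x, N (a *: x) = `|a| * N x &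
  exists2 c : R, 0 < c & forall x, `|x| <= c * N x /\ N x <= c * `|x|].

Variables (N : X -> R) (eN : equivalent_norm N).

Lemma eqnormD x y : N (x + y) <= N x + N y.
Proof. by case: eN. Qed.

Lemma eqnormZ (a : R) x : N (a *: x) = `|a| * N x.
Proof. by case: eN. Qed.

Lemma eqnormN x : N (- x) = N x.
Proof. by rewrite -scaleN1r eqnormZ normrN1 mul1r. Qed.

Lemma eqnorm0 : N 0 = 0.
Proof. by rewrite -(scale0r 0) eqnormZ normr0 mul0r. Qed.

Lemma eqnorm_ge0 x : 0 <= N x.
Proof.
have [_ _ [c c0 /(_ x)[h _]]] := eN.
by rewrite -(pmulr_rge0 _ c0); exact: le_trans h.
Qed.

Lemma eqnormB x y : N (x - y) <= N x + N y.
Proof. by rewrite -(eqnormN y) eqnormD. Qed.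

Lemma eqnorm_distC x y : N (x - y) = N (y - x).
Proof. by rewrite -eqnormN opprB. Qed.

Lemma eqnorm_distD y x w : N (x - w) <= N (x - y) + N (y - w).
Proof. by rewrite -(subrKA y) eqnormD. Qed.

Lemma eqnorm_le0 x : N x <= 0 -> x = 0.
Proof.
move=> Nx; have [_ _ [c c0 /(_ x)[h _]]] := eN.
by apply/eqP; rewrite -normr_le0 (le_trans h) // pmulr_rle0.
Qed.

Lemma eqnorm_upper : exists2 c : R, 0 < c & forall x, N x <= c * `|x|.
Proof. by have [_ _ [c c0 h]] := eN; exists c => // x; case: (h x). Qed.

Lemma eqnorm_lower : exists2 c : R, 0 < c & forall x, `|x| <= c * N x.
Proof. by have [_ _ [c c0 h]] := eN; exists c => // x; case: (h x). Qed.

Lemma eqnorm_small (e : R) : 0 < e ->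
  exists2 d : R, 0 < d & forall x, `|x| < d -> N x < e.
Proof.
move=> e0; have [c c0 h] := eqnorm_upper.
exists (e / c); first by rewrite divr_gt0.
by move=> x; rewrite ltr_pdivlMr // mulrC; exact: le_lt_trans.
Qed.

Lemma small_eqnorm (e : R) : 0 < e ->
  exists2 d : R, 0 < d & forall x, N x < d -> `|x| < e.
Proof.
move=> e0; have [c c0 h] := eqnorm_lower.
exists (e / c); first by rewrite divr_gt0.
by move=> x; rewrite ltr_pdivlMr // mulrC; exact: le_lt_trans.
Qed.

Lemma cvg_seq_eqnormP (u : nat -> X) (l : X) :
  u n @[n --> \oo] --> l <->
  forall e : R, 0 < e -> exists k, forall n, (k <= n)%N -> N (u n - l) < e.
Proof.
split=> [/cvg_seqP ul e e0|ul].
- have [d d0 hd] := eqnorm_small e0; have [k hk] := ul d d0.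
  by exists k => n kn; apply: hd; exact: hk.
- apply/cvg_seqP => e e0; have [d d0 hd] := small_eqnorm e0; have [k hk] := ul d d0.
  by exists k => n kn; apply: hd; exact: hk.
Qed.

Lemma cvg_right_eqnormP (f : R -> X) (l : X) :
  f h @[h --> 0^'+] --> l <-> forall e, 0 < e ->
    exists2 d, 0 < d & forall h, 0 < h -> h < d -> N (f h - l) < e.
Proof.
split=> [/cvg_rightP ul e e0|ul].
- have [d d0 hd] := eqnorm_small e0; have [k k0 hk] := ul d d0.
  by exists k => // h h0 hk'; apply: hd; exact: hk.
- apply/cvg_rightP => e e0; have [d d0 hd] := small_eqnorm e0; have [k k0 hk] := ul d d0.
  by exists k => // h h0 hk'; apply: hd; exact: hk.
Qed.

Lemma dense_eqnorm (D : set X) x (e : R) : dense D -> 0 < e ->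
  exists2 y, D y & N (x - y) < e.
Proof.
move=> dD e0; have [d d0 hd] := eqnorm_small e0.
by have [y Dy xy] := dense_ball x dD d0; exists y => //; exact: hd.
Qed.

Lemma eqnorm_lim_le (u : nat -> X) (l : X) (r : R) :
  u n @[n --> \oo] --> l -> (forall n, N (u n) <= r) -> N l <= r.
Proof.
move=> /cvg_seq_eqnormP ul ur; apply/ler_addgt0Pr => e e0.
have [k hk] := ul e e0; have := hk k (leqnn k); rewrite eqnorm_distC => h.
by have := eqnormD (u k) (l - u k); rewrite addrC subrK; have := ur k; lra.
Qed.

(** A map that contracts an equivalent norm need not contract the norm itself,
    but its iterates still converge geometrically. *)
Lemma eqnorm_fixed_point (f : X -> X) : geometrically_complete X ->
  (forall x y, N (f x - f y) <= 2^-1 * N (x - y)) -> exists x, f x = x.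
Proof.
move=> cX fN; pose u n := iter n f 0.
have uN n : N (u n.+1 - u n) <= N (f 0) * 2^-1 ^+ n.
  elim: n => [|n IH]; first by rewrite /u /= subr0 expr0 mulr1.
  by rewrite exprS mulrCA (le_trans (fN _ _)) // ler_wpM2l // invr_ge0.
have [c c0 hc] := eqnorm_lower.
have [n|l ul] := cX u (c * N (f 0)).
  by rewrite (le_trans (hc _)) // -mulrA ler_wpM2l // ltW.
exists l; apply/subr0_eq/eqnorm_le0/ler_addgt0Pr => e e0.
have := (cvg_seq_eqnormP _ _).1 ul (e / 2); rewrite divr_gt0 // => /(_ isT)[k hk].
have := hk k (leqnn k); have := hk k.+1 (leqW (leqnn k)).
have := fN l (u k); rewrite (eqnorm_distC l (u k)) -[f (u k)]/(u k.+1).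
have := eqnorm_distD (u k.+1) (f l) l; lra.
Qed.

End EquivalentNorm.

Section Gauge.
Variables (R : realType) (X : normedModType R).
Implicit Types (K : set X) (x y z : X) (r : R).

Definition solid_cone K z := [/\ closed_convex_cone K,
  forall x, K x -> K (- x) -> x = 0, normal_cone K & interior K z].

Definition order_bound K z r x := K (r *: z - x) /\ K (r *: z + x).

(** The Minkowski functional of the order interval from [- z] to [z]. *)
Definition gauge K z x := inf [set r | 0 <= r /\ order_bound K z r x].

Variables (K : set X) (z : X) (sK : solid_cone K z).

Lemma solid_cone_interior x : interior K x -> solid_cone K x.
Proof. by case: sK. Qed.

Lemma coneD x y : K x -> K y -> K (x + y).
Proof. by case: sK => [[_ h _] _ _ _]; exact: h. Qed.

Lemma coneZ r x : 0 <= r -> K x -> K (r *: x).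
Proof. by case: sK => [[_ _ h] _ _ _]; exact: h. Qed.

Lemma cone_unit : K z.
Proof. by case: sK => _ _ _; exact: interior_subset. Qed.

Lemma cone0 : K 0.
Proof. by rewrite -(scale0r z); apply: coneZ => //; exact: cone_unit. Qed.

Lemma cone_lim x : (forall e : R, 0 < e -> exists2 y, K y & `|y - x| < e) -> K x.
Proof.
case: sK => [[clK _ _] _ _ _] h; apply: clK => B /nbhs_ballP[e /= e0 eB].
have [y Ky yx] := h e e0; exists y; split => //; apply: eB.
by rewrite -ball_normE /= distrC.
Qed.

Lemma cone_unit_small x : (forall e, 0 < e -> K (x + e *: z)) -> K x.
Proof.
move=> h; apply: cone_lim => e e0.
exists (x + (e / (`|z| + 1)) *: z).
  by apply: h; rewrite divr_gt0 // ltr_wpDl.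
rewrite addrC addKr normrZ ger0_norm ?divr_ge0 ?ltW // ?ltr_wpDl //.
by rewrite mulrAC ltr_pdivrMr ?ltr_wpDl // ltr_pM2l // ltrDl.
Qed.

(** The point [z + (c |x|)^-1 x] lies in a ball around [z] that is contained in the
    cone. *)
Lemma order_unit : exists2 c : R, 0 < c & forall x, K ((c * `|x|) *: z + x).
Proof.
case: sK => _ _ _ /interior_ball[e e0 he].
exists (2 / e); first by rewrite divr_gt0.
move=> x; have [->|x0] := eqVneq x 0.
  by rewrite normr0 mulr0 scale0r addr0; exact: cone0.
have c0 : 0 < 2 / e * `|x| by rewrite mulr_gt0 ?divr_gt0 ?normr_gt0.
set c := 2 / e * `|x| in c0 *.
have -> : c *: z + x = c *: (z + c^-1 *: x).
  by rewrite scalerDr scalerA mulfV ?lt0r_neq0 // scale1r.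
apply: coneZ; first exact: ltW.
apply: he; rewrite addrAC subrr add0r normrZ gtr0_norm ?invr_gt0 //.
rewrite /c invfM -mulrA mulVf ?normr_eq0 // mulr1 invf_div.
by rewrite ltr_pdivrMr //; lra.
Qed.

Lemma order_bound_mono r r' x : r <= r' -> order_bound K z r x -> order_bound K z r' x.
Proof.
move=> rr' [h1 h2]; have Kd : K ((r' - r) *: z).
  by apply: coneZ; [rewrite subr_ge0|exact: cone_unit].
by split; rewrite -(subrK r r') scalerDl -addrA; apply: coneD.
Qed.

Lemma gauge_set_nonempty x : [set r | 0 <= r /\ order_bound K z r x] !=set0.
Proof.
have [c c0 hc] := order_unit; exists (c * `|x|); split.
  by rewrite mulr_ge0 // ltW.
by split; [rewrite -(normrN x)|]; exact: hc.
Qed.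

Lemma gauge_ge0 x : 0 <= gauge K z x.
Proof. by apply: lb_le_inf; [exact: gauge_set_nonempty|move=> r []]. Qed.

Lemma gauge_le r x : 0 <= r -> order_bound K z r x -> gauge K z x <= r.
Proof. by move=> r0 h; apply: ge_inf => //; exists 0 => s []. Qed.

Lemma gauge_bound r x : gauge K z x <= r -> order_bound K z r x.
Proof.
move=> xr; apply: order_bound_mono xr _.
have hb e : 0 < e -> order_bound K z (gauge K z x + e) x.
  move=> e0; have hi : has_inf [set r | 0 <= r /\ order_bound K z r x].
    by split; [exact: gauge_set_nonempty|exists 0 => s []].
  have [s [s0 hs] se] := inf_adherent e0 hi.
  by apply: order_bound_mono hs; exact: ltW.
by split; apply: cone_unit_small => e /hb[h1 h2]; rewrite addrAC -scalerDl.
Qed.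

Lemma gauge_unit : gauge K z z <= 1.
Proof.
apply: gauge_le => //; rewrite /order_bound scale1r subrr; split; first exact: cone0.
by apply: coneD; exact: cone_unit.
Qed.

(** The gauge is bounded by the norm because [z] is an order unit.  Conversely, with [g]
    the gauge of [x], normality applies to [0 <= g z + x <= 2 g z]. *)
Lemma gauge_equivalent : equivalent_norm (gauge K z).
Proof.
split.
- move=> x y; apply: gauge_le; first by rewrite addr_ge0 // gauge_ge0.
  have [x1 x2] := gauge_bound (lexx (gauge K z x)).
  have [y1 y2] := gauge_bound (lexx (gauge K z y)).
  by split; rewrite scalerDl ?opprD addrACA; exact: coneD.
- have gZ (a : R) x : gauge K z (a *: x) <= `|a| * gauge K z x.
    apply: gauge_le; first by rewrite mulr_ge0 // gauge_ge0.
    have [x1 x2] := gauge_bound (lexx (gauge K z x)).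
    have [a0|a0] := leP 0 a.
      by rewrite ger0_norm //; split; rewrite -scalerA -?scalerBr -?scalerDr; exact: coneZ.
    rewrite ltr0_norm // -(opprK (a *: x)) -scaleNr; rewrite -oppr_gt0 in a0.
    by split; rewrite ?opprK -scalerA -?scalerBr -?scalerDr; apply: coneZ => //; exact: ltW.
  move=> a x; apply/le_anti; rewrite gZ /=.
  have [->|a0] := eqVneq a 0; first by rewrite normr0 mul0r gauge_ge0.
  rewrite -ler_pdivlMl ?normr_gt0 // -normfV.
  by have := gZ a^-1 (a *: x); rewrite scalerA mulVf // scale1r.
- have [c c0 hc] := order_unit; case: (sK) => _ _ [C C0 hC] _.
  pose D := 1 + (2 * C + 1) * `|z|.
  have D1 : 1 <= D by rewrite lerDl mulr_ge0 // addr_ge0 // mulr_ge0 // ltW.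
  exists (c + D); first by rewrite addr_gt0 //; apply: lt_le_trans D1.
  move=> x; split; last first.
    apply: (@le_trans _ _ (c * `|x|)); last by rewrite ler_wpM2r // lerDl (le_trans ler01).
    apply: gauge_le; first by rewrite mulr_ge0 // ltW.
    by split; [rewrite -(normrN x)|]; exact: hc.
  set g := gauge K z x; have g0 : 0 <= g := gauge_ge0 x.
  have [x1 x2] := gauge_bound (lexx g).
  have := hC (g *: z + x) ((2 * g) *: z).
  rewrite /cone_le subr0 => /(_ x2).
  have -> : (2 * g) *: z - (g *: z + x) = g *: z - x.
    by rewrite opprD addrA -scalerBl; congr (_ *: z - x); lra.
  move=> /(_ x1); rewrite normrZ ger0_norm ?mulr_ge0 // => h.
  have h' : `|x| <= `|g *: z + x| + `|g *: z|.
    by rewrite -[x in X in X <= _](addKr (g *: z)) addrC ler_normB.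
  rewrite normrZ ger0_norm // in h'.
  apply: (@le_trans _ _ (D * g)); last by rewrite ler_wpM2r // lerDr ltW.
  rewrite /D mulrDl mul1r.
  apply: (le_trans h'); apply: (le_trans (lerD h (lexx _))).
  rewrite -subr_ge0; apply: le_trans g0 _.
  by rewrite -subr_ge0 le_eqVlt; apply/orP; left; apply/eqP; ring.
Qed.

Lemma interior_dominates x : interior K x -> exists2 e : R, 0 < e & K (x - e *: z).
Proof.
move=> /interior_ball[e e0 he]; exists (e / (`|z| + 1)).
  by rewrite divr_gt0 // ltr_wpDl.
apply: he; rewrite addrAC subrr add0r normrN normrZ.
rewrite ger0_norm ?divr_ge0 ?ltW // ?ltr_wpDl //.
by rewrite mulrAC ltr_pdivrMr ?ltr_wpDl // ltr_pM2l // ltrDl.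
Qed.

Lemma dominates_interior x (e : R) : 0 < e -> K (x - e *: z) -> interior K x.
Proof.
move=> e0 Kx; have [c c0 hc] := order_unit.
apply: (@ball_interior _ _ _ _ (e / c)); first by rewrite divr_gt0.
move=> y yx.
have -> : y = (x - e *: z) +
    (((e - c * `|y - x|) *: z) + ((c * `|y - x|) *: z + (y - x))).
  by rewrite scalerBl (addrA (e *: z - _)) subrK addrA subrK addrC subrK.
apply: coneD => //; apply: coneD => //; apply: coneZ; last exact: cone_unit.
by rewrite subr_ge0 mulrC -ler_pdivlMr // ltW.
Qed.

End Gauge.

(** * Partially defined linear operators *)
Section LinearOperator.
Variables (K : pzRingType) (V : lmodType K) (A : operator V).
Hypothesis lA : linear_operator A.

Lemma dom0 : dom A 0. Proof. by case: lA. Qed.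

Lemma domZD (a : K) x y : dom A x -> dom A y -> dom A (a *: x + y).
Proof. by move=> hx hy; case: lA => _ /(_ a x y hx hy)[]. Qed.

Lemma opZD (a : K) x y : dom A x -> dom A y -> A (a *: x + y) = a *: A x + A y.
Proof. by move=> hx hy; case: lA => _ /(_ a x y hx hy)[]. Qed.

Lemma op0 : A 0 = 0.
Proof.
have := opZD 1 dom0 dom0; rewrite !scale1r addr0 => /eqP.
by rewrite -[X in X == _]addr0 (inj_eq (addrI _)) => /eqP.
Qed.

Lemma domD x y : dom A x -> dom A y -> dom A (x + y).
Proof. by move=> hx hy; rewrite -(scale1r x); exact: domZD. Qed.

Lemma opD x y : dom A x -> dom A y -> A (x + y) = A x + A y.
Proof. by move=> hx hy; rewrite -{1}(scale1r x) opZD // scale1r. Qed.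

Lemma domZ (a : K) x : dom A x -> dom A (a *: x).
Proof. by move=> hx; rewrite -(addr0 (a *: x)); apply: domZD => //; exact: dom0. Qed.

Lemma opZ (a : K) x : dom A x -> A (a *: x) = a *: A x.
Proof. by move=> hx; rewrite -[in LHS](addr0 (a *: x)) opZD ?op0 ?addr0 //; exact: dom0. Qed.

Lemma domN x : dom A x -> dom A (- x).
Proof. by move=> hx; rewrite -scaleN1r; exact: domZ. Qed.

Lemma opN x : dom A x -> A (- x) = - A x.
Proof. by move=> hx; rewrite -scaleN1r opZ // scaleN1r. Qed.

Lemma domB x y : dom A x -> dom A y -> dom A (x - y).
Proof. by move=> hx hy; apply: domD => //; exact: domN. Qed.

Lemma opB x y : dom A x -> dom A y -> A (x - y) = A x - A y.
Proof. by move=> hx hy; rewrite opD ?opN //; exact: domN. Qed.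


End LinearOperator.

Definition shift_operator (R : pzRingType) (V : lmodType R) (A : operator V) (c : R) :=
  Operator (dom A) (fun x => A x - c *: x).

Lemma shift_linear (R : comPzRingType) (V : lmodType R) (A : operator V) (c : R) :
  linear_operator A -> linear_operator (shift_operator A c).
Proof.
move=> lA; split; first exact: (dom0 lA).
move=> a x y dx dy; split; first exact: (domZD lA).
rewrite /= (opZD lA) // scalerDr opprD addrACA scalerBr !scalerA.
by rewrite (mulrC c a).
Qed.

Lemma shift_operatorK (R : pzRingType) (V : lmodType R) (A : operator V) (c : R) :
  shift_operator (shift_operator A c) (- c) = A.
Proof.
rewrite /shift_operator /=; case: A => D F /=; congr Operator; apply/funext => x.
by rewrite scaleNr opprK subrK.
Qed.

Section Contractions.
Variables (R : realType) (X : normedModType R) (N : X -> R).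
Hypothesis eN : equivalent_norm N.

Lemma eqnorm_contraction_continuous (f : X -> X) :
  linear f -> (forall x, N (f x) <= N x) -> continuous f.
Proof.
move=> lf fc.
have [c c0 hc] := eqnorm_upper eN; have [c' c'0 hc'] := eqnorm_lower eN.
apply: (linear_bound_continuous lf (M := c' * c)) => x.
rewrite -mulrA; apply: (le_trans (hc' _)); rewrite ler_pM2l //.
exact: le_trans (fc x) (hc x).
Qed.

(** The difference is the telescoping sum of the [P^(n - 1 - k) (P - Q) Q^k x], and
    each term is at most [N (P x - Q x)] because [P] and [Q] commute. *)
Lemma iter_contraction_diff (P Q : X -> X) n x :
  {morph P : x y / x - y} -> {morph Q : x y / x - y} ->
  (forall x, N (P x) <= N x) -> (forall x, N (Q x) <= N x) ->
  (forall x, P (Q x) = Q (P x)) ->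
  N (iter n P x - iter n Q x) <= n%:R * N (P x - Q x).
Proof.
move=> PB QB Pc Qc PQ; elim: n x => [|n IH] x.
  by rewrite /= subrr (eqnorm0 eN) mul0r.
have iterPB m y y' : iter m P (y - y') = iter m P y - iter m P y'.
  by elim: m => //= m ->; rewrite PB.
have iterPc m y : N (iter m P y) <= N y.
  by elim: m => //= m; apply: le_trans.
rewrite !iterSr (le_trans (eqnorm_distD eN (iter n P (Q x)) _ _)) //.
rewrite -iterPB -natr1 mulrDl mul1r addrC lerD //.
apply: (le_trans (IH _)); rewrite ler_wpM2l // PQ -QB; exact: Qc.
Qed.

End Contractions.

(** * The Lumer-Phillips theorem for an equivalent norm *)
Section LumerPhillips.
Variables (R : realType) (X : completeNormedModType R) (N : X -> R).
Variable B : operator X.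
Hypothesis eN : equivalent_norm N.
Hypothesis lB : linear_operator B.
Hypothesis dB : dense (dom B).
Hypothesis surjB : forall (h : R) y, 0 < h -> exists2 x, dom B x & x - h *: B x = y.
Hypothesis dissB : forall (h : R) x, 0 < h -> dom B x -> N x <= N (x - h *: B x).

(** The implicit Euler step [(1 - h B)^-1].  The identity at [h = 0] lets the estimates
    below include times [0]. *)
Definition euler_step (h : R) (y : X) : X :=
  if 0 < h then xget 0 [set x | dom B x /\ x - h *: B x = y] else y.
Local Notation J := euler_step.

Lemma euler_stepP h y : 0 < h -> dom B (J h y) /\ J h y - h *: B (J h y) = y.
Proof.
move=> h0; rewrite /J h0; have [x Bx xy] := surjB y h0.
by apply: (@xgetPex _ 0 [set x | dom B x /\ x - h *: B x = y]); exists x.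
Qed.

Lemma euler_dom h y : 0 < h -> dom B (J h y).
Proof. by move=> /(euler_stepP y)[]. Qed.

Lemma euler_eq h y : 0 < h -> J h y - h *: B (J h y) = y.
Proof. by move=> /(euler_stepP y)[]. Qed.

Lemma euler0 y : J 0 y = y.
Proof. by rewrite /J ltxx. Qed.

Lemma euler_inj h x y : 0 < h -> dom B x -> dom B y ->
  x - h *: B x = y - h *: B y -> x = y.
Proof.
move=> h0 Bx By xy; apply/subr0_eq/(eqnorm_le0 eN).
apply: le_trans (dissB h0 (domB lB Bx By)) _.
by rewrite (opB lB) // scalerBr subrACA xy subrr (eqnorm0 eN).
Qed.

Lemma euler_uniq h x : 0 < h -> dom B x -> J h (x - h *: B x) = x.
Proof.
move=> h0 Bx; have [Jd Je] := euler_stepP (x - h *: B x) h0.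
exact: (euler_inj h0 Jd Bx Je).
Qed.

Lemma euler_solve h x y : 0 < h -> dom B x -> x - h *: B x = y -> J h y = x.
Proof. by move=> h0 Bx <-; exact: euler_uniq. Qed.

Lemma euler_linear h : 0 <= h -> linear (J h).
Proof.
rewrite le_eqVlt => /orP[/eqP <- a x y|h0 a x y]; first by rewrite !euler0.
have [xd xe] := euler_stepP x h0; have [yd ye] := euler_stepP y h0.
apply: euler_solve => //; first exact: (domZD lB).
rewrite (opZD lB) // -[in RHS]xe -[in RHS]ye scalerDr opprD addrACA.
by rewrite scalerBr !scalerA (mulrC h a).
Qed.

Lemma euler_scale h a x : 0 <= h -> J h (a *: x) = a *: J h x.
Proof. by move=> h0; exact: linear_mapZ (euler_linear h0) _ _. Qed.

Lemma euler_sub h : 0 <= h -> {morph J h : x y / x - y}.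
Proof. by move=> h0 x y; exact: linear_mapB (euler_linear h0) _ _. Qed.

Lemma euler_contr h y : 0 <= h -> N (J h y) <= N y.
Proof.
rewrite le_eqVlt => /orP[/eqP <-|h0]; first by rewrite euler0.
by have [d e] := euler_stepP y h0; apply: (le_trans (dissB h0 d)); rewrite e.
Qed.

Lemma euler_diff h x : 0 < h -> J h x - x = h *: B (J h x).
Proof.
by move=> h0; rewrite -[X in _ - X](euler_eq x h0) opprB addrC subrK.
Qed.

Lemma euler_op h x : 0 <= h -> dom B x -> dom B (J h x) /\ B (J h x) = J h (B x).
Proof.
rewrite le_eqVlt => /orP[/eqP <-|h0] Bx; first by rewrite !euler0.
have [d e] := euler_stepP x h0; split=> //.
have BJ : B (J h x) = h^-1 *: (J h x - x).
  by rewrite euler_diff // scalerA mulVf ?scale1r // lt0r_neq0.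
have BJd : dom B (B (J h x)) by rewrite BJ; apply: (domZ lB); exact: (domB lB).
apply/esym/euler_solve => //.
by rewrite -[in RHS]e (opB lB) ?(opZ lB) //; exact: (domZ lB).
Qed.

Lemma euler_comm a b x : 0 <= a -> 0 <= b -> J a (J b x) = J b (J a x).
Proof.
rewrite le_eqVlt => /orP[/eqP <-|a0]; first by rewrite !euler0.
move=> b0; have [d e] := euler_stepP x a0.
have [d' e'] := euler_op b0 d.
by apply: euler_solve => //; rewrite e' -[in RHS]e (euler_sub b0) euler_scale.
Qed.

Definition dom2 : set X := [set x | dom B x /\ dom B (B x)].

Lemma euler_dom2 h x : 0 < h -> dom B x -> dom2 (J h x).
Proof.
move=> h0 Bx; split; first exact: euler_dom.
by rewrite (euler_op (ltW h0) Bx).2; exact: euler_dom.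
Qed.

Lemma euler_sub_le h x : 0 <= h -> dom B x -> N (J h x - x) <= h * N (B x).
Proof.
move=> h0 Bx.
have -> : J h x - x = h *: J h (B x).
  move: h0; rewrite le_eqVlt => /orP[/eqP <-|h0]; first by rewrite euler0 subrr scale0r.
  by rewrite euler_diff // (euler_op (ltW h0) Bx).2.
by rewrite (eqnormZ eN) ger0_norm // ler_wpM2l // euler_contr.
Qed.

(** Both [1 - (a + b) B] and [(1 - a B) (1 - b B)] have the same expansion up to
    the term [a b B^2], which makes the step [a + b] a second order
    approximation of a step [b] followed by a step [a]. *)
Lemma euler_add a b x : 0 <= a -> 0 <= b -> dom2 x ->
  N (J a (J b x) - J (a + b) x) <= a * b * N (B (B x)).
Proof.
move=> a0 b0 [Bx BBx].
have [ab0|] := ltP 0 (a + b); last first.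
  move=> ab; have [-> ->] : a = 0 /\ b = 0 by split; lra.
  by rewrite addr0 !euler0 subrr (eqnorm0 eN) !mul0r.
have [d1 e1] := euler_op b0 Bx; have [d2 e2] := euler_op a0 d1.
have [d3 e3] := euler_op b0 BBx; have [d4 e4] := euler_op a0 d3.
set w := J a (J b x) in d2 e2 *.
have wE : w - (a + b) *: B w = x - (a * b) *: J a (J b (B (B x))).
  have bE y : J b y - b *: B (J b y) = y.
    move: (b0); rewrite le_eqVlt => /orP[/eqP <-|/euler_eq //].
    by rewrite euler0 scale0r subr0.
  have aE y : J a y - a *: B (J a y) = y.
    move: (a0); rewrite le_eqVlt => /orP[/eqP <-|/euler_eq //].
    by rewrite euler0 scale0r subr0.
  have Ex : x = J b x - b *: J b (B x) by rewrite -e1 bE.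
  have EP : J b x = w - a *: J a (J b (B x)) by rewrite -e1 -e2 aE.
  have EQ : J b (B x) = J a (J b (B x)) - a *: J a (J b (B (B x))).
    by rewrite -e3 -e4 aE.
  rewrite [X in _ = X - _]Ex EP {2}EQ e2 e1 scalerBr scalerA (mulrC b a) opprB addrA.
  by rewrite addrAC addrK scalerDl opprD addrA.
have wd : dom B w by [].
have : J (a + b) x - w = (a * b) *: J (a + b) (J a (J b (B (B x)))).
  rewrite -[in LHS](euler_uniq ab0 wd) wE -(euler_sub (ltW ab0)) opprB [x + _]addrC subrK.
  exact: euler_scale (ltW ab0).
move=> E; rewrite (eqnorm_distC eN) E (eqnormZ eN) ger0_norm ?mulr_ge0 //.
rewrite ler_wpM2l ?mulr_ge0 //.
by do 2 (apply: le_trans (euler_contr _ _) _; first by [exact: ltW|]); rewrite euler_contr.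
Qed.

(** The approximation is [J h x] for small [h]: it commutes with [B], and [J h] tends
    strongly to the identity. *)
Lemma dom2_approx x e : 0 < e -> dom B x ->
  exists2 y, dom2 y & N (x - y) < e /\ N (B x - B y) < e.
Proof.
move=> e0 Bx.
have lim y : exists2 d : R, 0 < d & forall h, 0 < h -> h < d -> N (y - J h y) < e.
  have e3 : 0 < e / 3 by rewrite divr_gt0.
  have [y' By' yy'] := dense_eqnorm eN y dB e3.
  exists (e / 3 / (N (B y') + 1)).
    by rewrite !divr_gt0 // ltr_wpDl // (eqnorm_ge0 eN).
  move=> h h0; rewrite ltr_pdivlMr ?ltr_wpDl ?(eqnorm_ge0 eN) // mulrDr mulr1 => hd.
  have := eqnorm_distD eN y' y (J h y); have := eqnorm_distD eN (J h y') y' (J h y).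
  have := euler_sub_le (ltW h0) By'; rewrite (eqnorm_distC eN (J h y') y').
  have := euler_contr (y' - y) (ltW h0).
  by rewrite euler_sub ?(ltW h0) // (eqnorm_distC eN y' y); lra.
have [d1 d10 h1] := lim x; have [d2 d20 h2] := lim (B x).
pose h := Num.min d1 d2 / 2.
have m0 : 0 < Num.min d1 d2 by rewrite lt_min d10.
have h0 : 0 < h by rewrite divr_gt0.
have : h < Num.min d1 d2 by rewrite /h ltr_pdivrMr //; lra.
rewrite lt_min => /andP[hd1 hd2].
exists (J h x); first exact: euler_dom2.
by rewrite (euler_op (ltW h0) Bx).2; split; [exact: h1|exact: h2].
Qed.

Lemma dom2_dense x e : 0 < e -> exists2 y, dom2 y & N (x - y) < e.
Proof.
move=> e0; have e2 : 0 < e / 2 by rewrite divr_gt0.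
have [y By xy] := dense_eqnorm eN x dB e2.
have [w Bw [yw _]] := dom2_approx e2 By.
by exists w => //; have := eqnorm_distD eN y x w; lra.
Qed.

Definition euler_approx (k : nat) (t : R) : X -> X :=
  iter (2 ^ k) (J (t * 2^-1 ^+ k)).
Local Notation u := euler_approx.

Lemma step_ge0 (k : nat) (t : R) : 0 <= t -> 0 <= t * 2^-1 ^+ k.
Proof. by move=> t0; rewrite mulr_ge0 // exprn_ge0 // invr_ge0. Qed.

Lemma pow2_half (k : nat) : (2 ^ k)%:R * 2^-1 ^+ k = 1 :> R.
Proof. by rewrite natrX -exprMn mulfV ?expr1n. Qed.

Lemma euler_approx_linear k t : 0 <= t -> linear (u k t).
Proof.
move=> t0 a x y; rewrite /u; elim: (2 ^ k)%N => //= n ->.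
exact: euler_linear (step_ge0 k t0) _ _ _.
Qed.

Lemma euler_approx_sub k t : 0 <= t -> {morph u k t : x y / x - y}.
Proof. by move=> t0 x y; exact: linear_mapB (euler_approx_linear k t0) _ _. Qed.

Lemma euler_approx_contr k t x : 0 <= t -> N (u k t x) <= N x.
Proof.
move=> t0; rewrite /u; elim: (2 ^ k)%N => //= n; apply: le_trans.
exact: euler_contr (step_ge0 k t0).
Qed.

Lemma euler_approx_add k s t x : 0 <= s -> 0 <= t -> dom2 x ->
  N (u k s (u k t x) - u k (s + t) x) <= s * t * N (B (B x)) * 2^-1 ^+ k.
Proof.
move=> s0 t0 x2; rewrite /u; set n := (2 ^ k)%N.
have a0 := step_ge0 k s0; have b0 := step_ge0 k t0.
set a := s * 2^-1 ^+ k in a0 *; set b := t * 2^-1 ^+ k in b0 *.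
have -> : iter n (J a) (iter n (J b) x) = iter n (J a \o J b) x.
  have comm m w : iter m (J a) (J b w) = J b (iter m (J a) w).
    by elim: m => //= m ->; rewrite euler_comm.
  by elim: n => //= m IH; rewrite -IH comm.
rewrite mulrDl -/a -/b.
have ab0 : 0 <= a + b by exact: addr_ge0.
apply: (le_trans (iter_contraction_diff eN _ _ _ _ _ _ _)).
- by move=> y y' /=; rewrite !euler_sub.
- exact: euler_sub.
- by move=> y /=; apply: (le_trans (euler_contr _ a0)); exact: euler_contr.
- by move=> y; exact: euler_contr.
- by move=> y /=; rewrite (euler_comm _ b0) // (euler_comm _ a0).
- rewrite /= (le_trans (ler_wpM2l _ (euler_add a0 b0 x2))) //.
  have := pow2_half k; rewrite -/n /a /b; set q := 2^-1 ^+ k => nq.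
  rewrite le_eqVlt; apply/orP; left; apply/eqP.
  transitivity (n%:R * q * (s * t * N (B (B x)) * q)); first by ring.
  by rewrite nq mul1r.
Qed.

(** Halving all the steps amounts to splitting the time [t] into [t / 2 + t / 2]. *)
Lemma euler_approx_step k t x : 0 <= t -> dom2 x ->
  N (u k.+1 t x - u k t x) <= t ^+ 2 / 4 * N (B (B x)) * 2^-1 ^+ k.
Proof.
move=> t0 x2; have t2 : 0 <= t / 2 by rewrite divr_ge0.
have -> : u k.+1 t x = u k (t / 2) (u k (t / 2) x).
  rewrite /u expnSr exprS mulrA muln2 -addnn iterD //.
have := euler_approx_add k t2 t2 x2; rewrite -splitr => /le_trans; apply.
by rewrite le_eqVlt; apply/orP; left; apply/eqP; field.
Qed.

Lemma euler_approx_cvg t x : 0 <= t -> exists l : X, u k t x @[k --> \oo] --> l.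
Proof.
move=> t0; have [c c0 hc] := eqnorm_lower eN.
have cvg2 y : dom2 y -> exists l : X, u k t y @[k --> \oo] --> l.
  move=> y2; apply: (@complete_geometrically _ _ _ (c * (t ^+ 2 / 4 * N (B (B y))))) => k.
  apply: (le_trans (hc _)); rewrite -[X in _ <= X]mulrA ler_wpM2l ?(ltW c0) //.
  exact: euler_approx_step.
apply/cvg_ex; apply: cauchy_cvg; apply/cauchyP => e e0.
have [d d0 hd] := small_eqnorm eN e0.
have d3 : 0 < d / 4 by rewrite divr_gt0.
have [y y2 xy] := dom2_dense x d3.
have [l /(cvg_seq_eqnormP eN)/(_ _ d3)[k hk]] := cvg2 y y2.
exists (u k t x), k => // n /= kn; rewrite -ball_normE /=; apply: hd.
have := eqnorm_distD eN (u k t y) (u k t x) (u n t x).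
have := eqnorm_distD eN (u n t y) (u k t y) (u n t x).
have := eqnorm_distD eN l (u k t y) (u n t y); rewrite (eqnorm_distC eN l).
have := hk k (leqnn k); have := hk n kn.
have := euler_approx_contr k (x - y) t0; have := euler_approx_contr n (y - x) t0.
by rewrite !euler_approx_sub // (eqnorm_distC eN y x); lra.
Qed.

Definition euler_limit (t : R) (x : X) : X :=
  xget 0 [set l : X | u k t x @[k --> \oo] --> l].
Local Notation S := euler_limit.

Lemma euler_limitP t x : 0 <= t -> u k t x @[k --> \oo] --> S t x.
Proof.
move=> t0; have [l hl] := euler_approx_cvg x t0.
by apply: (@xgetPex _ 0 [set l : X | u k t x @[k --> \oo] --> l]); exists l.
Qed.

Arguments euler_limitP : clear implicits.

Lemma euler_limit_uniq t x l : 0 <= t -> u k t x @[k --> \oo] --> l -> S t x = l.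
Proof. by move=> t0; apply: cvg_unique_norm; exact: euler_limitP. Qed.

Lemma euler_limit0 x : S 0 x = x.
Proof.
apply: euler_limit_uniq => //; apply/cvg_seqP => e e0; exists 0%N => k _.
rewrite /u mul0r; set m := (2 ^ k)%N.
have -> : iter m (J 0) x = x by elim: m => //= m ->; rewrite euler0.
by rewrite subrr normr0.
Qed.

Lemma euler_limit_linear t : 0 <= t -> linear (S t).
Proof.
move=> t0 a x y; apply: euler_limit_uniq => //.
have -> : (fun k => u k t (a *: x + y)) = (fun k => a *: u k t x + u k t y).
  by apply/funext => k; exact: euler_approx_linear.
by apply: cvgD; [apply: cvgZ; first exact: cvg_cst|]; exact: euler_limitP.
Qed.

Lemma euler_limit_sub t : 0 <= t -> {morph S t : x y / x - y}.
Proof. by move=> t0 x y; exact: linear_mapB (euler_limit_linear t0) _ _. Qed.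

Lemma euler_limit_contr t x : 0 <= t -> N (S t x) <= N x.
Proof.
move=> t0; apply: (eqnorm_lim_le eN (euler_limitP t x t0)) => k.
exact: euler_approx_contr.
Qed.

Lemma euler_limit_add s t x : 0 <= s -> 0 <= t -> S (s + t) x = S s (S t x).
Proof.
move=> s0 t0; have st0 : 0 <= s + t by exact: addr_ge0.
suff H y : dom2 y -> S (s + t) y = S s (S t y).
  apply/subr0_eq/(eqnorm_le0 eN)/ler_addgt0Pr => e e0; rewrite add0r.
  have e2 : 0 < e / 2 by rewrite divr_gt0.
  have [y y2 xy] := dom2_dense x e2.
  have := eqnorm_distD eN (S (s + t) y) (S (s + t) x) (S s (S t x)).
  rewrite {2}(H _ y2) -(euler_limit_sub st0) -(euler_limit_sub s0) -(euler_limit_sub t0).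
  have := euler_limit_contr (x - y) st0.
  have := euler_limit_contr (S t (y - x)) s0; have := euler_limit_contr (y - x) t0.
  by rewrite (eqnorm_distC eN y x); lra.
move=> y2; apply: euler_limit_uniq => //; apply/(cvg_seq_eqnormP eN) => e e0.
have e3 : 0 < e / 3 by rewrite divr_gt0.
have [k1 hk1] := (cvg_seq_eqnormP eN _ _).1 (euler_limitP t y t0) _ e3.
have [k2 hk2] := (cvg_seq_eqnormP eN _ _).1 (euler_limitP s (S t y) s0) _ e3.
have [k3 hk3] := half_pow_lt (s * t * N (B (B y))) e3.
exists (maxn k1 (maxn k2 k3)) => k; rewrite !geq_max => /and3P[/hk1 h1 /hk2 h2 /hk3 h3].
have := eqnorm_distD eN (u k s (u k t y)) (u k (s + t) y) (S s (S t y)).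
have := eqnorm_distD eN (u k s (S t y)) (u k s (u k t y)) (S s (S t y)).
have := euler_approx_add k s0 t0 y2; rewrite (eqnorm_distC eN _ (u k (s + t) y)).
have := euler_approx_contr k (u k t y - S t y) s0; rewrite euler_approx_sub //.
lra.
Qed.

(** The sum of the geometric series in [euler_approx_step]. *)
Lemma euler_limit_euler t x : 0 <= t -> dom2 x ->
  N (S t x - J t x) <= t ^+ 2 / 2 * N (B (B x)).
Proof.
move=> t0 x2.
have -> : J t x = u 0 t x by rewrite /u expr0 mulr1.
apply: (@eqnorm_lim_le _ _ _ eN (fun k => u k t x - u 0 t x)).
  by apply: cvgB; [exact: euler_limitP|exact: cvg_cst].
move=> k; have := geometric_increments (eqnorm0 eN) (eqnorm_ge0 eN) (eqnormD eN)
  (fun n => euler_approx_step n t0 x2) 0 k.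
rewrite add0n expr0 mulr1 => /le_trans; apply.
by rewrite le_eqVlt; apply/orP; left; apply/eqP; field.
Qed.

Lemma euler_limit_expand t x : 0 < t -> dom2 x ->
  N (S t x - x - t *: B x) <= 2 * t ^+ 2 * N (B (B x)).
Proof.
move=> t0 x2; have [Bx BBx] := x2.
have E : J t x - x - t *: B x = t *: (J t (B x) - B x).
  by rewrite euler_diff // (euler_op (ltW t0) Bx).2 scalerBr.
have h1 : N (J t x - x - t *: B x) <= t ^+ 2 * N (B (B x)).
  rewrite E (eqnormZ eN) gtr0_norm // expr2 -mulrA ler_wpM2l ?(ltW t0) //.
  exact: euler_sub_le (ltW t0) BBx.
have h2 := euler_limit_euler (ltW t0) x2.
have := eqnormD eN (S t x - J t x) (J t x - x - t *: B x).
rewrite !addrA subrK.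
have : 0 <= t ^+ 2 * N (B (B x)) by rewrite mulr_ge0 ?sqr_ge0 // (eqnorm_ge0 eN).
lra.
Qed.

Lemma euler_limit_sub_le t x : 0 <= t -> dom B x -> N (S t x - x) <= t * N (B x).
Proof.
move=> t0 Bx.
apply: (@eqnorm_lim_le _ _ _ eN (fun k => u k t x - x)).
  by apply: cvgB; [exact: euler_limitP|exact: cvg_cst].
move=> k; have a0 := step_ge0 k t0.
rewrite /u; set n := (2 ^ k)%N; set h := t * 2^-1 ^+ k in a0 *.
have idn : iter n id x = x by elim: n => //= n ->.
rewrite -[X in _ - X]idn.
apply: (le_trans (iter_contraction_diff eN _ _ (euler_sub a0) _ _ _ _)) => //.
  by move=> y; exact: euler_contr.
rewrite (le_trans (ler_wpM2l _ (euler_sub_le a0 Bx))) //.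
by rewrite mulrA /h mulrCA pow2_half mulr1.
Qed.

Lemma euler_limit_C0 : C0_semigroup S.
Proof.
split.
- move=> t t0; split; first exact: euler_limit_linear.
  apply: (eqnorm_contraction_continuous eN); first exact: euler_limit_linear.
  by move=> x; exact: euler_limit_contr.
- by apply/funext => x; rewrite euler_limit0.
- by move=> s t s0 t0; apply/funext => x; rewrite /= euler_limit_add.
- move=> x; apply/(cvg_right_eqnormP eN) => e e0.
  have e3 : 0 < e / 3 by rewrite divr_gt0.
  have [y By xy] := dense_eqnorm eN x dB e3.
  exists (e / 3 / (N (B y) + 1)).
    by rewrite divr_gt0 // ltr_wpDl // (eqnorm_ge0 eN).
  move=> t t0; rewrite ltr_pdivlMr ?ltr_wpDl ?(eqnorm_ge0 eN) // mulrDr mulr1 => td.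
  have := eqnorm_distD eN (S t y) (S t x) x; have := eqnorm_distD eN y (S t y) x.
  have := euler_limit_sub_le (ltW t0) By.
  have := euler_limit_contr (x - y) (ltW t0); rewrite euler_limit_sub ?(ltW t0) //.
  by rewrite (eqnorm_distC eN y x); lra.
Qed.

Lemma euler_limit_generator x : dom B x -> h^-1 *: (S h x - x) @[h --> 0^'+] --> B x.
Proof.
move=> Bx; apply/(cvg_right_eqnormP eN) => e e0.
have e4 : 0 < e / 4 by rewrite divr_gt0.
have [y y2 [_ xy]] := dom2_approx e4 Bx.
exists (e / 4 / (2 * N (B (B y)) + 1)).
  by rewrite divr_gt0 // ltr_wpDl // mulr_ge0 // (eqnorm_ge0 eN).
move=> t t0; rewrite ltr_pdivlMr ?ltr_wpDl ?mulr_ge0 ?(eqnorm_ge0 eN) //.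
rewrite mulrDr mulr1 => td; have t0' := ltW t0.
have -> : t^-1 *: (S t x - x) - B x = t^-1 *: (S t x - x - t *: B x).
  by rewrite [in RHS]scalerBr scalerA mulVf ?lt0r_neq0 // scale1r.
rewrite (eqnormZ eN) normfV gtr0_norm // ltr_pdivrMl //.
have -> : S t x - x - t *: B x =
    (S t (x - y) - (x - y)) + ((S t y - y - t *: B y) - t *: (B x - B y)).
  by rewrite euler_limit_sub // scalerBr; exact: sub_second_difference.
have h1 : N (S t (x - y) - (x - y)) <= t * N (B x - B y).
  by rewrite -(opB lB Bx y2.1); exact: (euler_limit_sub_le t0' (domB lB Bx y2.1)).
have h2 := euler_limit_expand t0 y2.
have h3 : N (t *: (B x - B y)) = t * N (B x - B y) by rewrite (eqnormZ eN) gtr0_norm.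
have h4 : t * N (B x - B y) <= t * (e / 4) by rewrite ler_wpM2l // ltW.
have h5 : t * (t * (2 * N (B (B y)))) < t * (e / 4) by rewrite ltr_pM2l //; lra.
have te : 0 < t * e by rewrite mulr_gt0.
apply: (le_lt_trans (eqnormD eN _ _)); apply: (le_lt_trans (lerD h1 (eqnormB eN _ _))).
rewrite h3 (_ : t ^+ 2 = t * t) ?expr2 // in h2 *; lra.
Qed.

(** The generator [G] extends [B].  As [1 - B] is onto and [1 - G] is one to one, the
    semigroup being contractive, the extension is not proper. *)
Lemma euler_limit_dom x :
  cvg (h^-1 *: (S h x - x) @[h --> 0^'+]) -> dom B x.
Proof.
move=> /cvg_ex[g hg]; have [y By yE] := surjB (x - g) ltr01.
suff -> : x = y by [].
apply/subr0_eq/(eqnorm_le0 eN)/ler_addgt0Pr => e e0; rewrite add0r.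
rewrite scale1r in yE.
have xyE : g - B y = x - y.
  by apply/esym/subr0_eq; rewrite subrACA yE subrr.
have hD : h^-1 *: (S h x - x) - h^-1 *: (S h y - y) @[h --> 0^'+] --> x - y.
  by rewrite -xyE; apply: cvgB hg _; exact: euler_limit_generator.
have [d d0 hd] := (cvg_right_eqnormP eN _ _).1 hD e e0.
pose h := d / 2; have h0 : 0 < h by rewrite divr_gt0.
have := hd h h0; rewrite /h ltr_pdivrMr // ltr_pMr // ltr1n -/h => /(_ isT) /=.
rewrite [X in N X](_ : _ = h^-1 *: (S h (x - y) - (1 + h) *: (x - y))); last first.
  rewrite scalerDl scale1r (opprD (x - y)) (addrA (S h (x - y))).
  rewrite (scalerBr _ (S h (x - y) - (x - y))) scalerA.
  rewrite mulVf ?lt0r_neq0 // scale1r (euler_limit_sub (ltW h0)) -scalerBr.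
  by rewrite (subrACA (S h x)).
rewrite (eqnormZ eN) normfV gtr0_norm // ltr_pdivrMl // => hN.
have h1 := euler_limit_contr (x - y) (ltW h0).
have h2 := eqnorm_distD eN (S h (x - y)) ((1 + h) *: (x - y)) 0.
rewrite !subr0 (eqnormZ eN) gtr0_norm ?addr_gt0 // (eqnorm_distC eN) in h2.
have : h * N (x - y) <= h * e by lra.
by rewrite ler_pM2l.
Qed.

Theorem lumer_phillips : exists S : R -> X -> X,
  generates B S /\ forall t x, 0 <= t -> N (S t x) <= N x.
Proof.
exists S; split; last by move=> t x; exact: euler_limit_contr.
split; first exact: euler_limit_C0.
split; last by move=> x; exact: euler_limit_generator.
apply/seteqP; split => x; last exact: euler_limit_dom.
by move=> /euler_limit_generator Bx; apply/cvg_ex; exists (B x).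
Qed.

End LumerPhillips.

(** * Rescaling a semigroup *)
Section Rescaling.
Variable R : realType.

(** The exponential lies between [1 + x] and [1 / (1 - x)]. *)
Lemma expR_sub1D_le (x : R) : `|x| <= 1 / 2 -> `|expR x - 1 - x| <= 2 * x ^+ 2.
Proof.
rewrite ler_norml => /andP[x1 x2].
have h1 := expR_ge1Dx x; have h2 := expR_ge1Dx (- x).
have h3 : expR x * expR (- x) = 1 by rewrite -expRD subrr expR0.
have h4 : expR x * (1 - x) <= 1 by have := ler_wpM2l (expR_ge0 x) h2; rewrite h3.
rewrite ger0_norm; last by lra.
have h5 : 0 < 1 - x by lra.
rewrite -(ler_pM2r h5).
have : 0 <= x ^+ 2 * (1 - 2 * x) by rewrite mulr_ge0 ?sqr_ge0 //; lra.
rewrite !expr2; nra.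
Qed.

Lemma expR_right_derivative (c : R) :
  h^-1 * (expR (c * h) - 1) @[h --> 0^'+] --> (c : R^o).
Proof.
apply/cvg_rightP => e e0.
pose D := 2 * (c ^+ 2 + 1) + 2 * `|c| + 1.
have c20 : 0 <= c ^+ 2 by exact: sqr_ge0.
have nc0 : 0 <= `|c| by [].
have D0 : 0 < D by rewrite /D; lra.
exists (Num.min 1 e / D); first by rewrite divr_gt0 // lt_min ltr01.
move=> h h0; rewrite ltr_pdivlMr // lt_min => /andP[h1 he].
have ch : `|c * h| <= 1 / 2.
  rewrite normrM (gtr0_norm h0); have : 0 <= h * (c ^+ 2 + 1).
    by rewrite mulr_ge0 ?addr_ge0 ?sqr_ge0 // ltW.
  by rewrite /D in h1; nra.
have -> : h^-1 * (expR (c * h) - 1) - c = h^-1 * (expR (c * h) - 1 - c * h).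
  by rewrite [in RHS]mulrBr mulrCA mulVf ?mulr1 // lt0r_neq0.
rewrite normrM normfV (gtr0_norm h0) ltr_pdivrMl //.
apply: (le_lt_trans (expR_sub1D_le ch)).
rewrite exprMn; have : 0 <= h * `|c| by rewrite mulr_ge0 // ltW.
have -> : 2 * (c ^+ 2 * h ^+ 2) = h * (2 * h * c ^+ 2) by ring.
by move=> hc; rewrite ltr_pM2l //; rewrite /D in he; nra.
Qed.

Lemma expR_right_continuous (c : R) : expR (c * h) @[h --> 0^'+] --> (1 : R^o).
Proof.
have hc : c * h @[h --> (0 : R)] --> c * 0 by exact: mulrl_continuous.
have := cvg_comp _ _ hc (@continuous_expR R (c * 0)).
by rewrite mulr0 expR0; exact: cvg_at_right_filter.
Qed.

Variable X : normedModType R.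

Lemma rescaled_quotient (c : R) (S : R -> X -> X) (x y : X) :
  h^-1 *: (S h x - x) @[h --> 0^'+] --> y ->
  h^-1 *: (expR (c * h) *: S h x - x) @[h --> 0^'+] --> y + c *: x.
Proof.
move=> Sx.
have -> : (fun h => h^-1 *: (expR (c * h) *: S h x - x)) =
  (fun h => expR (c * h) *: (h^-1 *: (S h x - x)) +
            (h^-1 * (expR (c * h) - 1)) *: x).
  apply/funext => h; rewrite -(scalerA h^-1) (scalerA _ h^-1) (mulrC _ h^-1) -(scalerA h^-1).
  by rewrite -scalerDr (scalerBr (expR _)) scalerBl scale1r addrA subrK.
rewrite -[y in y + _]scale1r; apply: cvgD.
  by apply: cvgZ Sx; exact: expR_right_continuous.
by apply: cvgZ (cvg_cst _); exact: expR_right_derivative.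
Qed.

(** The inclusion of the domain of the new generator in that of [A] holds by rescaling
    back with [- c]. *)
Lemma rescaled_generates (c : R) (A : operator X) (S : R -> X -> X) :
  generates (shift_operator A c) S ->
  generates A (fun t x => expR (c * t) *: S t x).
Proof.
move=> [[Slin S0 Sadd Scont] [/= Sdom Sgen]]; split; [split|split].
- move=> t t0; have [l1 l2] := Slin t t0; split.
    by move=> a x y; rewrite l1 scalerDr scalerA mulrC -scalerA.
  by move=> x; apply: cvgZ (l2 x); exact: cvg_cst.
- by apply/funext => x; rewrite mulr0 expR0 scale1r S0.
- move=> s t s0 t0; apply/funext => x /=.
  have ls := (Slin s s0).1.
  by rewrite Sadd // mulrDr expRD /= (linear_mapZ ls) scalerA.
- move=> x; rewrite -[x in _ --> x]scale1r; apply: cvgZ (Scont x).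
  exact: expR_right_continuous.
- rewrite Sdom; apply/seteqP; split => x /= /cvg_ex[y hy]; apply/cvg_ex.
    by exists (y + c *: x); exact: rescaled_quotient.
  exists (y + - c *: x).
  have E : (fun h => h^-1 *: (S h x - x)) =
      (fun h => h^-1 *: (expR (- c * h) *: (expR (c * h) *: S h x) - x)).
    by apply/funext => h; rewrite scalerA -expRD -mulrDl addNr mul0r expR0 scale1r.
  by rewrite E; exact: rescaled_quotient (fun h x => expR (c * h) *: S h x) _ _ hy.
- by move=> x /Sgen /(rescaled_quotient (c := c)); rewrite subrK.
Qed.

End Rescaling.

(** * Points of positive resolvent *)
Section ResolventPositive.
Variables (R : realType) (X : completeNormedModType R).
Implicit Types (K : set X) (A : operator X) (x y z : X) (l mu c : R).

(** Existence and positivity of the resolvent at a real point, stated without the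
    complexification.  Injectivity of [l - A] follows from the second clause when the
    cone is proper, and boundedness of the inverse from positivity. *)
Definition pos_resolvent K A l :=
  (forall y, exists2 x, dom A x & l *: x - A x = y) /\
  (forall x, dom A x -> K (l *: x - A x) -> K x).

Lemma scaleC_real l (v : complexification X) :
  real_complex R l *: v = (l *: v.1, l *: v.2).
Proof.
by rewrite [LHS]/(scaleC _ _) /scaleC /= !scale0r subr0 addr0.
Qed.

Lemma resolvent_set_real A l : resolvent_set A (real_complex R l) ->
  forall y, exists2 x, dom A x & l *: x - A x = y.
Proof.
move=> [[_ _ surjA] _] y.
have [//|[x1 x2] /= [d1 _]] := surjA (y, 0).
by rewrite scaleC_real /= => -[e _]; exists x1.
Qed.

Lemma resolventK A lambda (v : complexification X) : resolvent_set A lambda ->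
  dom (complexify A) v -> resolvent A lambda (lambda *: v - complexify A v) = v.
Proof.
move=> [[_ injA _] _] dv; rewrite /resolvent pinvKV ?mem_set //.
Qed.

Lemma resolvent_real A l x : linear_operator A ->
  resolvent_set A (real_complex R l) -> dom A x ->
  resolvent A (real_complex R l) (l *: x - A x, 0) = (x, 0).
Proof.
move=> lA rl dx; pose v : complexification X := (x, 0).
have dv : dom (complexify A) v by split => //=; exact: dom0.
have E : real_complex R l *: v - complexify A v = (l *: x - A x, 0).
  by rewrite scaleC_real /= scaler0 (op0 lA) [LHS]surjective_pairing /= subr0.
by rewrite -E (resolventK rl dv).
Qed.

Lemma resolvent_positive_real K A l : linear_operator A ->
  resolvent_set A (real_complex R l) ->
  positive_map (complex_cone K) (resolvent A (real_complex R l)) ->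
  pos_resolvent K A l.
Proof.
move=> lA rl pl; split; first exact: resolvent_set_real.
move=> x dx Kx; have := pl (l *: x - A x, 0).
by rewrite (resolvent_real lA rl dx) => h; apply: (h _).1.
Qed.

End ResolventPositive.

Section PositiveResolvent.
Variables (R : realType) (X : completeNormedModType R).
Variables (K : set X) (z : X) (A : operator X).
Hypotheses (sK : solid_cone K z) (lA : linear_operator A).
Implicit Types (x y : X) (l mu c M : R).

Local Notation N := (gauge K z).
Local Notation eN := (gauge_equivalent sK).

Lemma shifted_ZD l a x y : dom A x -> dom A y ->
  l *: (a *: x + y) - A (a *: x + y) = a *: (l *: x - A x) + (l *: y - A y).
Proof.
move=> dx dy; rewrite (opZD lA) // scalerDr opprD addrACA scalerBr !scalerA.
by rewrite (mulrC l a).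
Qed.

Lemma shifted_B l x y : dom A x -> dom A y ->
  l *: (x - y) - A (x - y) = (l *: x - A x) - (l *: y - A y).
Proof. by move=> dx dy; rewrite (opB lA) // scalerBr subrACA. Qed.

Lemma shifted_N l x : dom A x -> l *: (- x) - A (- x) = - (l *: x - A x).
Proof. by move=> dx; rewrite (opN lA) // scalerN opprD. Qed.

Lemma pos_resolvent_mono l x0 y (r : R) :
  pos_resolvent K A l -> dom A x0 -> l *: x0 - A x0 = z ->
  dom A y -> K (r *: z + (l *: y - A y)) -> K (r *: x0 + y).
Proof.
move=> [_ pos] d0 e0 dy Ky; apply: pos; first exact: (domZD lA).
by rewrite shifted_ZD // e0.
Qed.

(** Positivity turns the bounds [- r z] and [r z] of [l y - A y] into the bounds [- r x0]
    and [r x0] of [y]. *)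
Lemma pos_resolvent_bound l x0 M y :
  pos_resolvent K A l -> dom A x0 -> l *: x0 - A x0 = z ->
  0 <= M -> K (M *: z - x0) ->
  dom A y -> N y <= M * N (l *: y - A y).
Proof.
move=> pl d0 e0 M0 Mx dy; set v := l *: y - A y.
have [v1 v2] := gauge_bound sK (lexx (N v)).
have Nv0 := gauge_ge0 sK v.
have y2 := pos_resolvent_mono pl d0 e0 dy v2.
have y1 : K (N v *: x0 - y).
  apply: (pos_resolvent_mono pl d0 e0); first exact: (domN lA).
  by rewrite shifted_N.
have E w : (M * N v) *: z + w = N v *: (M *: z - x0) + (N v *: x0 + w).
  by rewrite scalerBr scalerA (mulrC _ M) addrA subrK.
apply: gauge_le; first by rewrite mulr_ge0.
by split; rewrite E; apply: (coneD sK) => //; exact: (coneZ sK).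
Qed.

(** Moving down from a point [l] of positive resolvent: surjectivity is a Neumann
    series, and positivity survives because a lower bound [- rho z] of a solution
    with positive right-hand side improves to [- (rho / 2) z]. *)
Lemma pos_resolvent_shift l x0 M (eps : R) :
  pos_resolvent K A l -> dom A x0 -> l *: x0 - A x0 = z ->
  0 <= M -> K (M *: z - x0) -> 0 <= eps -> eps * M <= 2^-1 ->
  pos_resolvent K A (l - eps).
Proof.
move=> pl d0 e0 M0 Mx eps0 epsM; have [surj pos] := pl; split.
- move=> y.
  have [r hr] : exists r : X -> X, forall v, dom A (r v) /\ l *: r v - A (r v) = v.
    have /choice[r hr] : forall v, exists x, dom A x /\ l *: x - A x = v.
      by move=> v; have [x dx xv] := surj v; exists x.
    by exists r.
  pose f x := r (y + eps *: x).
  have [|x fx] := @eqnorm_fixed_point _ _ _ eN f (@complete_geometrically _ X).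
    move=> x x'; have [d1 e1] := hr (y + eps *: x); have [d2 e2] := hr (y + eps *: x').
    have := pos_resolvent_bound pl d0 e0 M0 Mx (domB lA d1 d2).
    rewrite shifted_B // e1 e2 opprD addrACA subrr add0r -scalerBr (eqnormZ eN).
    rewrite ger0_norm // mulrA (mulrC M) => h; apply: (le_trans h).
    by rewrite ler_wpM2r // (gauge_ge0 sK).
  have [d1 e1] := hr (y + eps *: x); rewrite -/(f x) fx in d1 e1.
  by exists x => //; rewrite scalerBl addrAC e1 addrK.
- move=> x dx Kx.
  have step (rho : R) : 0 <= rho -> K (rho *: z + x) -> K ((rho * 2^-1) *: z + x).
    move=> rho0 h.
    have h1 : K ((eps * rho) *: x0 + x).
      apply: (pos_resolvent_mono pl d0 e0 dx).
      have -> : (eps * rho) *: z + (l *: x - A x) =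
          eps *: (rho *: z + x) + ((l - eps) *: x - A x).
        rewrite scalerDr scalerA scalerBl -[RHS]addrA; congr (_ + _).
        by rewrite addrA (addrC (eps *: x)) subrK.
      by apply: (coneD sK) => //; exact: (coneZ sK).
    have -> : (rho * 2^-1) *: z + x = (rho * (2^-1 - eps * M)) *: z +
        ((eps * rho) *: (M *: z - x0) + ((eps * rho) *: x0 + x)).
      have -> : (eps * rho) *: (M *: z - x0) + ((eps * rho) *: x0 + x) =
          (eps * rho * M) *: z + x by rewrite scalerBr scalerA addrA subrK.
      by rewrite addrA -scalerDl; congr (_ *: _ + _); ring.
    apply: (coneD sK); last first.
      by apply: (coneD sK) => //; apply: (coneZ sK) => //; rewrite mulr_ge0.
    by apply: (coneZ sK); [rewrite mulr_ge0 // subr_ge0|exact: cone_unit sK].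
  have all n : K ((N x * 2^-1 ^+ n) *: z + x).
    elim: n => [|n IH]; first by rewrite expr0 mulr1; case: (gauge_bound sK (lexx (N x))).
    rewrite exprSr mulrA; apply: step => //.
    by rewrite mulr_ge0 ?(gauge_ge0 sK) // exprn_ge0 // invr_ge0.
  apply: (cone_unit_small sK) => e e1; have [k hk] := half_pow_lt (N x) e1.
  rewrite addrC -(subrK (N x * 2^-1 ^+ k) e) scalerDl -addrA; apply: (coneD sK) => //.
  by apply: (coneZ sK); [rewrite subr_ge0 ltW // hk|exact: cone_unit sK].
Qed.

(** The point [l0] is the infimum of the [l] such that all points from [l] on have
    positive resolvent.  If the image of [z] were at most [M z] at some [l] closer to [l0]
    than [1 / (2 M)], then [pos_resolvent_shift] would lead below [l0]. *)
Lemma not_pos_resolvent0 : (exists w, forall l, w < l -> pos_resolvent K A l) ->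
  ~ pos_resolvent K A 0 ->
  exists2 l0, 0 <= l0 & forall M, 0 < M -> exists2 d : R, 0 < d &
    forall l, l0 < l -> l < l0 + d -> pos_resolvent K A l /\
      forall x, dom A x -> l *: x - A x = z -> ~ K (M *: z - x).
Proof.
move=> [w hw] n0.
pose G := [set l | forall mu, l <= mu -> pos_resolvent K A mu].
have G1 : G (w + 1) by move=> mu hmu; apply: hw; lra.
have Gpos l : G l -> 0 <= l.
  by move=> Gl; rewrite leNgt; apply/negP => /ltW/Gl.
have lbG : has_lbound G by exists 0 => l /Gpos.
have iG : has_inf G by split => //; exists (w + 1).
exists (inf G); first by apply: lb_le_inf; [exists (w + 1)|move=> l /Gpos].
have Gl l : inf G < l -> pos_resolvent K A l.
  move=> hl; have hl' : 0 < l - inf G by rewrite subr_gt0.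
  have [g Gg gl] := inf_adherent hl' iG; apply: Gg; apply: ltW.
  by move: gl; rewrite addrC subrK.
move=> M M0; exists (2 * M)^-1; first by rewrite invr_gt0 mulr_gt0.
move=> l hl ld; split; first exact: Gl.
move=> x dx ex Mx.
have : inf G <= l - (2 * M)^-1; last by lra.
apply: ge_inf => // mu hmu; have [lmu|mul] := ltP l mu.
  by apply: Gl; exact: lt_trans lmu.
rewrite -(subKr l mu).
apply: (pos_resolvent_shift (Gl _ hl) dx ex (ltW M0) Mx); first by rewrite subr_ge0.
apply: (@le_trans _ _ ((2 * M)^-1 * M)); last by rewrite invfM -mulrA mulVf ?mulr1 // lt0r_neq0.
by rewrite ler_wpM2r ?(ltW M0) //; lra.
Qed.

(** Since [(mu - A) z >= (mu - c) z], the positive resolvent at [mu] maps [z] to at most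
    [z / (mu - c)], which bounds its gauge norm. *)
Lemma gauge_dissipative mu c x : pos_resolvent K A mu -> dom A z ->
  K (c *: z - A z) -> c < mu -> dom A x -> (mu - c) * N x <= N (mu *: x - A x).
Proof.
move=> [_ pos] dz Kz cmu; rewrite -subr_gt0 in cmu.
have half y : dom A y -> K ((N (mu *: y - A y) / (mu - c)) *: z + y).
  move=> dy; set v := mu *: y - A y; set r := N v / (mu - c).
  apply: pos; first exact: (domZD lA).
  rewrite shifted_ZD // -/v.
  have -> : r *: (mu *: z - A z) + v = r *: (c *: z - A z) + (N v *: z + v).
    have -> : mu *: z - A z = (mu - c) *: z + (c *: z - A z).
      by rewrite scalerBl addrA subrK.
    have -> : N v = r * (mu - c) by rewrite /r mulfVK // lt0r_neq0.
    by rewrite scalerDr scalerA (addrC _ (r *: (c *: z - A z))) -addrA.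
  apply: (coneD sK).
    by apply: (coneZ sK) => //; rewrite divr_ge0 ?(gauge_ge0 sK) // ltW.
  by case: (gauge_bound sK (lexx (N v))).
move=> dx; rewrite mulrC -ler_pdivlMr //.
apply: gauge_le; first by rewrite divr_ge0 ?(gauge_ge0 sK) // ltW.
split; last exact: half.
have := half (- x) (domN lA dx).
by rewrite shifted_N // (eqnormN eN).
Qed.

Lemma exists_growth_rate : exists2 c : R, 0 <= c & K (c *: z - A z).
Proof.
have [c c0 hc] := order_unit sK; exists (c * `|A z|); first by rewrite mulr_ge0 // ltW.
by rewrite -normrN; exact: hc.
Qed.

Lemma growth_rate_mono c c' : c <= c' -> K (c *: z - A z) -> K (c' *: z - A z).
Proof.
move=> cc' h; rewrite -(subrK c c') scalerDl -addrA; apply: (coneD sK) => //.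
by apply: (coneZ sK); [rewrite subr_ge0|exact: cone_unit sK].
Qed.

(** With [B = A - c], the equation [x - h B x = y] is [(h^-1 + c - A) x = h^-1 y]. *)
Lemma pos_resolvent_generates : dense (dom A) -> dom A z ->
  (exists w, forall l, w < l -> pos_resolvent K A l) ->
  exists T, generates A T.
Proof.
move=> dA dz [w hw]; have [c0 c00 hc0] := exists_growth_rate.
pose c := Num.max c0 w.
have hc : K (c *: z - A z) by apply: growth_rate_mono hc0; rewrite le_max lexx.
pose B := shift_operator A c; have lB := shift_linear c lA : linear_operator B.
have BE h x : 0 < h -> x - h *: B x = h *: ((h^-1 + c) *: x - A x).
  move=> h0; rewrite /= (scalerBr h (A x)) opprB (scalerBr h (_ *: x)) scalerDl.
  by rewrite (scalerDr h (h^-1 *: x)) (scalerA h h^-1) mulfV ?lt0r_neq0 // scale1r addrA.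
have ch h : 0 < h -> c < h^-1 + c by move=> h0; rewrite ltrDr invr_gt0.
have wh h : 0 < h -> pos_resolvent K A (h^-1 + c).
  by move=> h0; apply: hw; apply: le_lt_trans (ch h h0); rewrite le_max lexx orbT.
have surjB (h : R) y : 0 < h -> exists2 x, dom B x & x - h *: B x = y.
  move=> h0; have [surj _] := wh h h0; have [x dx ex] := surj (h^-1 *: y).
  by exists x => //; rewrite BE // ex scalerA mulfV ?scale1r // lt0r_neq0.
have dissB (h : R) x : 0 < h -> dom B x -> N x <= N (x - h *: B x).
  move=> h0 dx; rewrite BE // (eqnormZ eN) gtr0_norm //.
  have := gauge_dissipative (wh h h0) dz hc (ch h h0) dx.
  by rewrite addrK ler_pdivrMl.
have [S [gS _]] := lumer_phillips eN lB dA surjB dissB.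
by exists (fun t x => expR (c * t) *: S t x); exact: rescaled_generates.
Qed.

(** An interior point [w] of the cone in the domain has [- A w <= D z] for some [D], so
    that the positive operator [- A^-1] gives [w <= D x0]. *)
Lemma inverse_unit_interior x0 : dense (dom A) -> pos_resolvent K A 0 ->
  dom A x0 -> - A x0 = z -> interior K x0.
Proof.
move=> dA [_ pos] d0 e0.
have [w []] : exists w, interior K w /\ dom A w.
  have [|//|w [wK wA]] := dA (interior K); last by exists w.
    by exists z; case: sK.
  exact: open_interior.
move=> wi wd; have [C C0 hC] := order_unit sK.
have C1 : 0 < C * `|A w| + 1 by rewrite ltr_wpDl // mulr_ge0 // ltW.
set D := C * `|A w| + 1 in C1.
have KD : K (D *: x0 - w).
  apply: pos; first by apply: (domB lA) => //; exact: (domZ lA).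
  rewrite scale0r sub0r (opB lA) //; last exact: (domZ lA).
  rewrite (opZ lA) // opprB addrC -scalerN e0 /D scalerDl scale1r addrAC.
  by apply: (coneD sK); [exact: hC|exact: cone_unit sK].
have [e e1 he] := interior_dominates z wi.
apply: (@dominates_interior _ _ _ _ sK _ (D^-1 * e)); first by rewrite mulr_gt0 ?invr_gt0.
have -> : x0 - (D^-1 * e) *: z = D^-1 *: ((D *: x0 - w) + (w - e *: z)).
  by rewrite addrA subrK scalerBr !scalerA mulVf ?scale1r // lt0r_neq0.
apply: (coneZ sK); first by rewrite invr_ge0 ltW.
exact: (coneD sK).
Qed.

End PositiveResolvent.

(** * The spectral bound *)
Section RealSpectrum.
Variables (R : realType) (X : completeNormedModType R) (A : operator X).
Hypothesis lA : linear_operator A.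

Lemma resolvent_set_bounded (l : R) : resolvent_set A (real_complex R l) ->
  exists2 M : R, 0 < M & forall x, dom A x -> `|x| <= M * `|l *: x - A x|.
Proof.
move=> rl; have r0 := resolvent_real lA rl (dom0 lA).
rewrite scaler0 (op0 lA) subr0 in r0.
have nb : nbhs (resolvent A (real_complex R l) (0, 0))
    (ball (0, 0) (1 : R) : set (complexification X)).
  by rewrite r0; apply: nbhsx_ballx.
have := rl.2 (0, 0) _ nb; rewrite /= => /nbhs_ballP[d /= d0 hd].
exists (2 / d); first by rewrite divr_gt0.
move=> x dx; set v := l *: x - A x.
have [v0|v0] := eqVneq v 0.
  have := resolvent_real lA rl dx; rewrite -/v v0 r0 => /(congr1 fst)/= <-.
  by rewrite !normr0 mulr0.
have nv : 0 < `|v| by rewrite normr_gt0.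
pose a := d / (2 * `|v|); have a0 : 0 < a by rewrite divr_gt0 // mulr_gt0.
have dax : dom A (a *: x) by exact: (domZ lA).
have E : l *: (a *: x) - A (a *: x) = a *: v.
  by rewrite (opZ lA) // scalerBr !scalerA (mulrC l).
have : ball (0, 0) d (a *: v, 0 : X).
  split => /=; last exact: ballxx.
  rewrite -ball_normE /= sub0r normrN normrZ gtr0_norm // /a.
  by rewrite invfM mulrA mulfVK ?normr_eq0 // ltr_pdivrMr //; lra.
move=> /hd; rewrite /= -E (resolvent_real lA rl dax) => -[+ _] /=.
rewrite -ball_normE /= sub0r normrN normrZ gtr0_norm // => h.
have -> : 2 / d * `|v| = a^-1 * 1 by rewrite mulr1 /a invf_div mulrAC.
by rewrite ler_pdivlMl // ltW.
Qed.

(** Otherwise the critical point [l0 >= 0] of [not_pos_resolvent0] belongs to the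
    resolvent set, and the bound on the inverse of [l0 - A] persists, up to a factor
    [2], slightly to the right of [l0]. *)
Lemma spectral_bound_pos_resolvent (K : set X) (u : X) : solid_cone K u ->
  (exists w, forall l, w < l -> pos_resolvent K A l) ->
  (spectral_bound A < 0)%E -> pos_resolvent K A 0.
Proof.
move=> sK hw sA; have [//|n0] := pselect (pos_resolvent K A 0); exfalso.
have [l0 l00 hl] := not_pos_resolvent0 sK lA hw n0.
have rl0 : resolvent_set A (real_complex R l0).
  have [//|nr] := pselect (resolvent_set A (real_complex R l0)); exfalso.
  have : (l0%:E <= spectral_bound A)%E.
    by apply: ereal_sup_ubound; exists (real_complex R l0).
  by move=> /le_lt_trans/(_ sA); rewrite lte_fin ltNge l00.
have [M1 M10 hM1] := resolvent_set_bounded rl0.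
have eN := gauge_equivalent sK; set N := gauge K u in eN.
have [M M0 hM] : exists2 M : R, 0 < M & forall x, dom A x -> N x <= M * N (l0 *: x - A x).
  have [c c0 hc] := eqnorm_upper eN; have [c' c'0 hc'] := eqnorm_lower eN.
  exists (c * (M1 * c')); first by rewrite !mulr_gt0.
  move=> x dx; apply: (le_trans (hc _)); rewrite -mulrA ler_pM2l //.
  by apply: (le_trans (hM1 _ dx)); rewrite -mulrA ler_pM2l.
have [d d0 hd] := hl (2 * M) (mulr_gt0 (ltr0Sn R 1) M0).
pose e := Num.min d (2 * M)^-1 / 2.
have M2 : 0 < (2 * M)^-1 by rewrite invr_gt0 mulr_gt0.
have m0 : 0 < Num.min d (2 * M)^-1 by rewrite lt_min d0.
have e0 : 0 < e by rewrite divr_gt0.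
have : e < Num.min d (2 * M)^-1 by rewrite /e ltr_pdivrMr //; lra.
rewrite lt_min => /andP[ed eM].
have [||[surj pos] nK] := hd (l0 + e); [lra|lra|].
have [x dx ex] := surj u; apply: (nK x dx ex).
have E : l0 *: x - A x = u - e *: x.
  by rewrite -ex scalerDl addrAC addrK.
have := hM x dx; rewrite E => h1.
have h2 := eqnormB eN u (e *: x); rewrite (eqnormZ eN) gtr0_norm // in h2.
have h3 : N u <= 1 := gauge_unit sK.
have h4 : e * M <= 2^-1.
  apply: (@le_trans _ _ ((2 * M)^-1 * M)); first by rewrite ler_pM2r // ltW.
  by rewrite invfM -mulrA mulVf ?mulr1 // lt0r_neq0.
have h5 : N x <= 2 * M.
  have Nx0 := eqnorm_ge0 eN x.
  have h6 : M * N (u - e *: x) <= M * (1 + e * N x) by rewrite ler_pM2l //; lra.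
  have h7 : e * M * N x <= 2^-1 * N x by rewrite ler_wpM2r.
  have h8 : M * (1 + e * N x) = M + e * M * N x by ring.
  lra.
by have [] := gauge_bound sK h5.
Qed.

End RealSpectrum.

Section ComplexSpectrum.
Variables (R : realType) (X : completeNormedModType R) (N : X -> R).
Hypothesis eN : equivalent_norm N.
Local Notation XC := (complexification X).

(** The supremum of [N] over the real parts of the multiples of [v] by the closed
    complex unit disc.  Unlike the product norm it is homogeneous for complex
    scalars. *)
Definition complex_norm (v : X * X) : R :=
  sup [set N (p.1 *: v.1 + p.2 *: v.2) |
       p in [set p : R * R | p.1 ^+ 2 + p.2 ^+ 2 <= 1]].

Lemma sqr_sum_bound (a b : R) : a ^+ 2 + b ^+ 2 <= 1 -> `|a| <= 1 /\ `|b| <= 1.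
Proof.
move=> h; have := sqr_ge0 b; have := sqr_ge0 a.
move=> a0 b0.
by split; rewrite -(ler_pXn2r (ltn0Sn 1)) ?nnegrE // expr1n real_normK ?num_real //; lra.
Qed.

Lemma complex_norm_ub (v : X * X) (a b : R) : a ^+ 2 + b ^+ 2 <= 1 ->
  N (a *: v.1 + b *: v.2) <= complex_norm v.
Proof.
move=> ab; apply: ub_le_sup; last by exists (a, b).
exists (N v.1 + N v.2) => _ [[a' b'] /= /sqr_sum_bound[a1 b1] <-].
apply: (le_trans (eqnormD eN _ _)); rewrite !(eqnormZ eN).
by apply: lerD; rewrite ler_piMl ?(eqnorm_ge0 eN).
Qed.

Lemma complex_norm_le (v : X * X) (r : R) :
  (forall a b, a ^+ 2 + b ^+ 2 <= 1 -> N (a *: v.1 + b *: v.2) <= r) ->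
  complex_norm v <= r.
Proof.
move=> h; apply: ge_sup; last by move=> _ [[a b] /= ab <-]; exact: h.
by exists (N (0 *: v.1 + 0 *: v.2)); exists (0, 0) => //=; rewrite expr0n addr0 ler01.
Qed.

Lemma complex_norm_ge0 v : 0 <= complex_norm v.
Proof.
apply: le_trans (complex_norm_ub v (a := 0) (b := 0) _); first exact: eqnorm_ge0 eN _.
by rewrite expr0n addr0 ler01.
Qed.

Lemma complex_norm_ub_scale (v : X * X) (a b t : R) : 0 <= t ->
  a ^+ 2 + b ^+ 2 <= t ^+ 2 -> N (a *: v.1 + b *: v.2) <= t * complex_norm v.
Proof.
rewrite le_eqVlt => /orP[/eqP <-|t0] h.
  have : a = 0 /\ b = 0.
    have := sqr_ge0 a; have := sqr_ge0 b; rewrite expr0n /= in h => b0 a0.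
    by split; apply/eqP; rewrite -sqrf_eq0; apply/eqP; lra.
  by move=> [-> ->]; rewrite !scale0r addr0 (eqnorm0 eN) mul0r.
have -> : a *: v.1 + b *: v.2 = t *: ((a / t) *: v.1 + (b / t) *: v.2).
  by rewrite scalerDr !scalerA !(mulrC t) !mulfVK ?lt0r_neq0.
rewrite (eqnormZ eN) gtr0_norm // ler_pM2l //; apply: complex_norm_ub.
by rewrite !exprMn -mulrDl exprVn ler_pdivrMr ?exprn_gt0 // mul1r.
Qed.

(** Any [t] above the modulus of the scalar is allowed, which spares computing with
    square roots. *)
Lemma complex_normZ (v : XC) (alpha beta t : R) : 0 <= t ->
  alpha ^+ 2 + beta ^+ 2 <= t ^+ 2 ->
  complex_norm (Complex alpha beta *: v) <= t * complex_norm v.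
Proof.
move=> t0 h; apply: complex_norm_le => a b ab.
have -> : (Complex alpha beta *: v : XC) =
  (alpha *: v.1 - beta *: v.2, alpha *: v.2 + beta *: v.1) by [].
rewrite /=.
have -> : a *: (alpha *: v.1 - beta *: v.2) + b *: (alpha *: v.2 + beta *: v.1) =
   (a * alpha + b * beta) *: v.1 + (b * alpha - a * beta) *: v.2.
  rewrite !scalerBr !scalerDr !scalerA !scalerDl scaleNr addrACA.
  by rewrite (addrC (- _)) -!addrA; congr (_ + _); rewrite addrCA.
apply: complex_norm_ub_scale => //.
have -> : (a * alpha + b * beta) ^+ 2 + (b * alpha - a * beta) ^+ 2 =
  (a ^+ 2 + b ^+ 2) * (alpha ^+ 2 + beta ^+ 2) by ring.
by apply: le_trans (h); apply: ler_piMl => //; apply: addr_ge0; exact: sqr_ge0.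
Qed.

Lemma complex_norm_equivalent : equivalent_norm complex_norm.
Proof.
have [c c0 hc] := eqnorm_upper eN; have [c' c'0 hc'] := eqnorm_lower eN.
have n1 (w : X * X) : `|w.1| <= `|w| by rewrite prod_normE le_max lexx.
have n2 (w : X * X) : `|w.2| <= `|w| by rewrite prod_normE le_max lexx orbT.
split.
- move=> v w; apply: complex_norm_le => a b ab /=.
  rewrite !scalerDr addrACA; apply: (le_trans (eqnormD eN _ _)).
  by apply: lerD; exact: complex_norm_ub.
- have Z (a : R) v : complex_norm (a *: v) <= `|a| * complex_norm v.
    apply: complex_norm_le => p q pq /=.
    rewrite !scalerA !(mulrC _ a) -!scalerA -scalerDr (eqnormZ eN).
    by rewrite ler_wpM2l // complex_norm_ub.
  move=> a v; apply/le_anti; rewrite Z /=.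
  have [->|a0] := eqVneq a 0; first by rewrite normr0 mul0r complex_norm_ge0.
  rewrite -ler_pdivlMl ?normr_gt0 // -normfV.
  by have := Z a^-1 (a *: v); rewrite scalerA mulVf // scale1r.
- exists (2 * c + c'); first by rewrite addr_gt0 // mulr_gt0.
  move=> v; split.
    apply: (@le_trans _ _ (c' * complex_norm v)); last first.
      by rewrite ler_wpM2r ?complex_norm_ge0 // lerDr mulr_ge0 // ltW.
    rewrite prod_normE ge_max.
    apply/andP; split; apply: (le_trans (hc' _)); rewrite ler_pM2l //.
      have := complex_norm_ub v (a := 1) (b := 0); rewrite scale1r scale0r addr0; apply.
      by rewrite expr1n expr0n addr0.
    have := complex_norm_ub v (a := 0) (b := 1); rewrite scale1r scale0r add0r; apply.
    by rewrite expr1n expr0n add0r.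
  apply: (@le_trans _ _ (2 * c * `|v|)); last first.
    by rewrite ler_wpM2r // lerDl ltW.
  apply: complex_norm_le => a b /sqr_sum_bound[a1 b1].
  apply: (le_trans (eqnormD eN _ _)); rewrite !(eqnormZ eN) mulr2n mulrDl mul1r mulrDl.
  apply: lerD.
    apply: le_trans (ler_piMl (eqnorm_ge0 eN _) a1) _.
    by apply: (le_trans (hc _)); rewrite ler_pM2l.
  apply: le_trans (ler_piMl (eqnorm_ge0 eN _) b1) _.
  by apply: (le_trans (hc _)); rewrite ler_pM2l.
Qed.

End ComplexSpectrum.

Section HalfPlane.
Variables (R : realType) (X : completeNormedModType R).
Variables (K : set X) (z : X) (A : operator X) (c : R).
Hypotheses (sK : solid_cone K z) (lA : linear_operator A).
Hypotheses (dz : dom A z) (hc : K (c *: z - A z)).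
Hypothesis resA : exists w, forall l, w < l -> pos_resolvent K A l.

Local Notation XC := (complexification X).
Local Notation N := (gauge K z).
Local Notation eN := (gauge_equivalent sK).
Local Notation NC := (complex_norm N).
Local Notation eNC := (complex_norm_equivalent eN).
Local Notation AC := (complexify A).
Implicit Types (v w : XC).

Lemma complexify_linear : linear_operator AC.
Proof.
split; first by split; exact: dom0.
move=> a v w [v1 v2] [w1 w2].
have d (p q : R) x y : dom A x -> dom A y -> dom A (p *: x + q *: y).
  by move=> dx dy; apply: (domZD lA) => //; exact: (domZ lA).
have e (p q : R) x y : dom A x -> dom A y -> A (p *: x + q *: y) = p *: A x + q *: A y.
  by move=> dx dy; rewrite (opZD lA) ?(opZ lA) //; exact: (domZ lA).
have E1 : (a *: v + w).1 = complex.Re a *: v.1 + - complex.Im a *: v.2 + w.1.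
  by rewrite scaleNr.
have E2 : (a *: v + w).2 = complex.Re a *: v.2 + complex.Im a *: v.1 + w.2 by [].
split; first by split; rewrite ?E1 ?E2; apply: (domD lA) => //; exact: d.
have F1 : A (a *: v + w).1 = complex.Re a *: A v.1 + - complex.Im a *: A v.2 + A w.1.
  by rewrite E1 (opD lA) ?e //; exact: d.
have F2 : A (a *: v + w).2 = complex.Re a *: A v.2 + complex.Im a *: A v.1 + A w.2.
  by rewrite E2 (opD lA) ?e //; exact: d.
rewrite [LHS](_ : _ = (A (a *: v + w).1, A (a *: v + w).2)) // F1 F2 scaleNr.
by rewrite [RHS]surjective_pairing.
Qed.

Lemma complex_dissipative_real mu v : c < mu -> pos_resolvent K A mu -> dom AC v ->
  (mu - c) * NC v <= NC (real_complex R mu *: v - AC v).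
Proof.
move=> cmu pmu [v1 v2]; rewrite scaleC_real mulrC -ler_pdivlMr ?subr_gt0 //.
set y : XC := (_, _) - _; apply: complex_norm_le => a b ab.
have d1 := domZ lA a v1; have d2 := domZ lA b v2.
rewrite ler_pdivlMr ?subr_gt0 // mulrC.
apply: (le_trans (gauge_dissipative sK lA pmu dz hc cmu (domD lA d1 d2))).
have -> : mu *: (a *: v.1 + b *: v.2) - A (a *: v.1 + b *: v.2) = a *: y.1 + b *: y.2.
  have -> : y.1 = mu *: v.1 - A v.1 by rewrite /y /=.
  have -> : y.2 = mu *: v.2 - A v.2 by rewrite /y /=.
  rewrite (opD lA) // !(opZ lA) // scalerDr !scalerBr opprD addrACA !scalerA.
  by rewrite !(mulrC mu).
exact: (complex_norm_ub eN).
Qed.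

(** From [(mu - A) v = (lambda - A) v + (mu - lambda) v] and the estimate at the real
    point [mu], as [|mu - lambda| = mu - Re lambda + O(1 / mu)] for large [mu]. *)
Lemma complex_dissipative (al be : R) v : dom AC v ->
  (al - c) * NC v <= NC (Complex al be *: v - AC v).
Proof.
move=> dv; have [w hw] := resA; have v0 := complex_norm_ge0 eN v.
apply/ler_addgt0Pr => e e0.
pose D := be ^+ 2 * NC v / (2 * e) + `|w| + `|c| + `|al| + 1.
have q0 : 0 <= be ^+ 2 * NC v / (2 * e).
  apply: divr_ge0; first by rewrite mulr_ge0 ?sqr_ge0.
  by rewrite mulr_ge0 // ltW.
have D0 : 0 < D.
  by have := normr_ge0 w; have := normr_ge0 c; have := normr_ge0 al; rewrite /D; lra.
have wD : w < al + D /\ c < al + D.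
  have := ler_norm w; have := ler_norm c; have := ler_norm (- al); rewrite normrN.
  by have := normr_ge0 w; have := normr_ge0 c; rewrite /D; split; lra.
have := complex_dissipative_real wD.2 (hw _ wD.1) dv.
have -> : real_complex R (al + D) *: v - AC v =
   (Complex al be *: v - AC v) + Complex D (- be) *: v.
  rewrite addrAC -scalerDl; congr (_ *: _ - _).
  by apply/eqP; rewrite eq_complex /= subrr !eqxx.
move=> h; have := eqnormD eNC (Complex al be *: v - AC v) (Complex D (- be) *: v).
(* A bound for the modulus of [D - i be], by completing the square. *)
pose t := D + be ^+ 2 / (2 * D).
have t0 : 0 <= t by rewrite addr_ge0 ?(ltW D0) // divr_ge0 ?sqr_ge0 // mulr_ge0 // ltW.
have tD : D ^+ 2 + (- be) ^+ 2 <= t ^+ 2.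
  have -> : t ^+ 2 = D ^+ 2 + (- be) ^+ 2 + (be ^+ 2 / (2 * D)) ^+ 2.
    by rewrite /t; field; exact: lt0r_neq0.
  by rewrite lerDl sqr_ge0.
have h2 := complex_normZ eN v t0 tD.
have h3 : be ^+ 2 / (2 * D) * NC v <= e.
  rewrite mulrAC ler_pdivrMr ?mulr_gt0 //.
  have : be ^+ 2 * NC v / (2 * e) <= D.
    by have := normr_ge0 w; have := normr_ge0 c; have := normr_ge0 al; rewrite /D; lra.
  by rewrite ler_pdivrMr ?mulr_gt0 //; lra.
have h4 : t * NC v = D * NC v + be ^+ 2 / (2 * D) * NC v by rewrite /t mulrDl.
have h5 : (al + D - c) * NC v = (al - c) * NC v + D * NC v by ring.
lra.
Qed.

Definition shifted_onto (al be : R) := forall y : XC, exists2 v,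
  dom AC v & Complex al be *: v - AC v = y.

(** Surjectivity extends to a disc whose radius is given by [complex_dissipative]: the
    equation [(lambda + delta - A) v = y] is a fixed point problem for
    [v |-> (lambda - A)^-1 (y - delta v)]. *)
Lemma shifted_onto_step (al be d1 d2 : R) : c < al -> shifted_onto al be ->
  d1 ^+ 2 + d2 ^+ 2 <= ((al - c) / 2) ^+ 2 -> shifted_onto (al + d1) (be + d2).
Proof.
move=> cal on small y; have k0 : 0 < al - c by rewrite subr_gt0.
have /choice[r hr] : forall w : XC, exists v, dom AC v /\ Complex al be *: v - AC v = w.
  by move=> w; have [v dv vw] := on w; exists v.
pose f v := r (y - Complex d1 d2 *: v).
have lC := complexify_linear.
have cXC : geometrically_complete (X * X)%type.
  by apply: prod_geometrically; exact: complete_geometrically.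
have fc (v w : XC) : NC (f v - f w) <= 2^-1 * NC (v - w).
  have [dv ev] := hr (y - Complex d1 d2 *: v).
  have [dw ew] := hr (y - Complex d1 d2 *: w).
  have := complex_dissipative al be (domB lC dv dw).
  rewrite (opB lC) // scalerBr subrACA ev ew -/(f v) -/(f w).
  have -> : y - Complex d1 d2 *: v - (y - Complex d1 d2 *: w) = Complex d1 d2 *: (w - v).
    by rewrite opprB addrC addrA subrK -scalerBr.
  have k2 : 0 <= (al - c) / 2 by rewrite divr_ge0 // ltW.
  have := complex_normZ eN (w - v) k2 small; rewrite (eqnorm_distC eNC w v).
  by rewrite mulrAC -mulrA => h1 h2; have := le_trans h2 h1; rewrite ler_pM2l // mulrC.
have [v fv] : exists v : XC, f v = v := @eqnorm_fixed_point _ _ _ eNC f cXC fc.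
have [dv ev] := hr (y - Complex d1 d2 *: v); rewrite -/(f v) fv in dv ev.
exists v => //; have -> : Complex (al + d1) (be + d2) = Complex al be + Complex d1 d2.
  by apply/eqP; rewrite eq_complex /= !eqxx.
by rewrite scalerDl addrAC ev subrK.
Qed.

(** The segment from a large real [mu] to [al + i be] stays in [Re lambda >= al], where
    the radius of [shifted_onto_step] is bounded below, so finitely many steps cross
    it. *)
Lemma shifted_onto_half_plane (al be : R) : c < al -> shifted_onto al be.
Proof.
move=> cal; have [w hw] := resA.
pose mu := Num.max al w + 1.
have almu : al < mu by rewrite /mu ltr_pwDr // le_max lexx.
have wmu : w < mu by rewrite /mu ltr_pwDr // le_max lexx orbT.
have base : shifted_onto mu 0.
  move=> [y1 y2]; have [surj _] := hw _ wmu.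
  have [x1 d1 e1] := surj y1; have [x2 d2 e2] := surj y2.
  exists (x1, x2) => //; rewrite -[Complex mu 0]/(real_complex R mu) scaleC_real.
  by rewrite -e1 -e2.
have k0 : 0 < al - c by rewrite subr_gt0.
pose D := (mu - al) + `|be|.
have D0 : 0 <= D by rewrite addr_ge0 // subr_ge0 ltW.
pose n := (Num.truncn (2 * D / (al - c))).+1.
have n0 : 0 < n%:R :> R by rewrite ltr0n.
have Dn : D / n%:R <= (al - c) / 2.
  have : 2 * D / (al - c) < n%:R by exact: truncnS_gt.
  by rewrite ltr_pdivrMr // => h; rewrite ler_pdivrMr //; lra.
have [q1 Eq1] : exists q, q = (al - mu) / n%:R by eexists.
have [q2 Eq2] : exists q, q = be / n%:R by eexists.
have nq1 : n%:R * q1 = al - mu by rewrite Eq1 mulrC mulfVK // lt0r_neq0.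
have nq2 : n%:R * q2 = be by rewrite Eq2 mulrC mulfVK // lt0r_neq0.
have small : q1 ^+ 2 + q2 ^+ 2 <= (D / n%:R) ^+ 2.
  rewrite Eq1 Eq2 !exprMn -mulrDl ler_wpM2r ?sqr_ge0 //.
  have := real_normK (num_real be); have := normr_ge0 be; rewrite /D => b0 <-.
  have : 0 <= (mu - al) * `|be| by rewrite mulr_ge0 // subr_ge0 ltW.
  by nra.
have q10 : q1 <= 0 by rewrite Eq1 mulr_le0_ge0 ?invr_ge0 ?ler0n // subr_le0 ltW.
have all j : (j <= n)%N -> shifted_onto (mu + j%:R * q1) (j%:R * q2).
  elim: j => [|j IH] jn; first by rewrite !mul0r addr0.
  have jn' : j%:R <= n%:R :> R by rewrite ler_nat ltnW.
  rewrite -natr1 !mulrDl !mul1r addrA.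
  have alj : al <= mu + j%:R * q1.
    have : n%:R * q1 <= j%:R * q1 by rewrite ler_wnM2r.
    by rewrite nq1; lra.
  apply: shifted_onto_step; [exact: lt_le_trans cal alj|exact: IH (ltnW jn)|].
  apply: (le_trans small); rewrite ler_pXn2r ?nnegrE //.
  - by apply: (le_trans Dn); rewrite ler_pM2r //; lra.
  - by rewrite divr_ge0 // ltW.
  - by rewrite divr_ge0 // subr_ge0 (le_trans (ltW cal)).
have := all n (leqnn n); rewrite nq1 nq2.
by rewrite addrCA subrr addr0.
Qed.

Lemma half_plane_resolvent (al be : R) : c < al -> resolvent_set A (Complex al be).
Proof.
move=> cal; have lC := complexify_linear.
have on := shifted_onto_half_plane be cal; have k0 : 0 < al - c by rewrite subr_gt0.
set lam := Complex al be.
have inj v w : dom AC v -> dom AC w -> lam *: v - AC v = lam *: w - AC w -> v = w.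
  move=> dv dw e; apply/subr0_eq/(eqnorm_le0 eNC).
  have := complex_dissipative al be (domB lC dv dw).
  by rewrite (opB lC) // scalerBr subrACA e subrr (eqnorm0 eNC) pmulr_rle0.
have bij : set_bij (dom AC) setT (fun v => lam *: v - AC v).
  split => //; first by move=> v w /set_mem dv /set_mem dw; exact: inj.
  by move=> y _; have [v dv vy] := on y; exists v.
split => //.
have rP y : dom AC (resolvent A lam y) /\ lam *: resolvent A lam y - AC (resolvent A lam y) = y.
  have [v dv <-] := on y; rewrite /resolvent pinvKV ?mem_set //.
  by move=> a b /set_mem da /set_mem db; exact: inj.
move=> x; apply/cvgrPdist_lt => e e0.
have [d d0 hd] := small_eqnorm eNC e0.
have kd0 : 0 < (al - c) * d by rewrite mulr_gt0.
have [d' d'0 hd'] := eqnorm_small eNC kd0.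
have nb : nbhs x (ball x d') by exact: nbhsx_ballx.
apply: filterS nb => y; rewrite -ball_normE /= => xy.
apply: hd; have [dx ex] := rP x; have [dy ey] := rP y.
have := complex_dissipative al be (domB lC dx dy).
rewrite (opB lC) // scalerBr subrACA ex ey => h.
by rewrite -(ltr_pM2l k0); apply: (le_lt_trans h); exact: hd'.
Qed.

Lemma spectral_bound_le : (spectral_bound A <= c%:E)%E.
Proof.
apply: ge_ereal_sup => _ [[al be] /= nr <-]; rewrite lee_fin leNgt; apply/negP => cal.
by apply: nr; exact: half_plane_resolvent.
Qed.

End HalfPlane.

(** * Orbits of a semigroup and their order bounds *)
Section OrbitContinuity.
Variables (R : realType) (X : completeNormedModType R) (T : R -> X -> X).
Hypothesis C0T : C0_semigroup T.

Lemma sg_linear t : 0 <= t -> linear (T t).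
Proof. by case: C0T => h _ _ _ /h[]. Qed.

Lemma sg_continuous t : 0 <= t -> continuous (T t).
Proof. by case: C0T => h _ _ _ /h[]. Qed.

Lemma sg0 x : T 0 x = x.
Proof. by case: C0T => _ -> _ _. Qed.

Lemma sg_add s t x : 0 <= s -> 0 <= t -> T (s + t) x = T s (T t x).
Proof. by case: C0T => _ _ h _ s0 t0; rewrite h. Qed.

Lemma sg_right_continuous x (e : R) : 0 < e ->
  exists2 d : R, 0 < d & forall t, 0 <= t -> t < d -> `|T t x - x| < e.
Proof.
move=> e0; case: C0T => _ _ _ /(_ x)/cvg_rightP/(_ e e0)[d d0 hd].
exists d => // t; rewrite le_eqVlt => /orP[/eqP <- _|]; last exact: hd.
by rewrite sg0 subrr normr0.
Qed.

(** Strong continuity at [0] excludes unbounded operator norms near [0], by the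
    uniform boundedness principle. *)
Lemma sg_bounded_near0 : exists2 d : R, 0 < d & exists2 M : R, 1 <= M &
  forall t x, 0 <= t -> t < d -> `|T t x| <= M * `|x|.
Proof.
apply: contrapT => H.
have /choice[s hs] : forall n : nat, exists p : R * X,
    [/\ 0 <= p.1, p.1 < n.+1%:R^-1 & n.+1%:R * `|p.2| < `|T p.1 p.2|].
  move=> n; apply: contrapT => h; apply: H; exists n.+1%:R^-1; first by rewrite invr_gt0.
  exists n.+1%:R; first by rewrite ler1n.
  move=> t x t0 tn; rewrite leNgt; apply/negP => hx; apply: h.
  by exists (t, x).
pose F : set (X -> X) := [set T (s n).1 | n in setT].
have lin f : F f -> bounded_fun_norm f /\ linear f.
  move=> [n _ <-]; have [s0 _ _] := hs n; split; last exact: sg_linear.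
  have [M M0 hM] := continuous_linear_bound (sg_linear s0) (sg_continuous s0).
  move=> r; exists (M * r) => x xr; apply: (le_trans (hM x)).
  by rewrite ler_pM2l.
have ptw : pointwise_bounded F.
  move=> x; have [d d0 hd] := sg_right_continuous x ltr01.
  pose m := Num.truncn d^-1.
  exists ((`|x| + 1) + \sum_(i < m) `|T (s i).1 x|) => _ [n _ <-].
  have [s0 sn _] := hs n; have S0 : 0 <= \sum_(i < m) `|T (s i).1 x| by exact: sumr_ge0.
  have [mn|nm] := leqP m n.
    have sd : (s n).1 < d.
      apply: (lt_le_trans sn); rewrite invf_ple ?posrE //.
      apply: ltW; apply: (lt_le_trans (truncnS_gt _)); by rewrite ler_nat.
    have := hd _ s0 sd; have := ler_normD (T (s n).1 x - x) x; rewrite subrK; lra.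
  rewrite (bigD1 (Ordinal nm)) //= addrCA lerDl addr_ge0 //.
  exact: sumr_ge0.
have [M hM] := Banach_Steinhauss lin ptw 1.
pose n := Num.truncn (2 * M).
have [s0 _ ] := hs n; apply/negP; rewrite -leNgt.
have b x : `|x| < 1 -> `|T (s n).1 x| <= M.
  by move=> x1; apply: hM; [exists n|exact: ltW].
apply: (le_trans (linear_map_scale_bound (sg_linear s0) ltr01 b _)).
by rewrite ler_wpM2r // divr1 ltW // truncnS_gt.
Qed.

Lemma sg_bounded (a : R) : exists2 M : R, 0 < M &
  forall t x, 0 <= t -> t <= a -> `|T t x| <= M * `|x|.
Proof.
have [d d0 [M M1 hM]] := sg_bounded_near0.
have M0 : 0 < M by exact: lt_le_trans M1.
pose n := (Num.truncn (a / d)).+1; have n0 : 0 < n%:R :> R by rewrite ltr0n.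
have key m t x : 0 <= t -> t < d -> `|T (m%:R * t) x| <= M ^+ m * `|x|.
  move=> t0 td; elim: m => [|m IH]; first by rewrite mul0r sg0 expr0 mul1r.
  rewrite -natr1 mulrDl mul1r addrC sg_add ?mulr_ge0 //.
  by rewrite (le_trans (hM _ _ t0 td)) // exprS -mulrA ler_pM2l.
exists (M ^+ n); first by rewrite exprn_gt0.
move=> t x t0 ta; have -> : t = n%:R * (t / n%:R) by rewrite mulrC mulfVK // lt0r_neq0.
apply: key; first by rewrite divr_ge0 // ltW.
by rewrite ltr_pdivrMr // (le_lt_trans ta) // mulrC -ltr_pdivrMr // truncnS_gt.
Qed.

Lemma sg_left_continuous x t (e : R) : 0 < e -> exists2 d : R, 0 < d &
  forall s, 0 <= s -> t - d < s -> s <= t -> `|T s x - T t x| < e.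
Proof.
move=> e0; have [M M0 hM] := sg_bounded t.
have [d d0 hd] := sg_right_continuous x (divr_gt0 e0 M0).
exists d => // s s0 sd st; have ts : 0 <= t - s by rewrite subr_ge0.
have -> : T t x = T s (T (t - s) x) by rewrite -sg_add // addrC subrK.
rewrite distrC -(linear_mapB (sg_linear s0)); apply: (le_lt_trans (hM _ _ s0 st)).
rewrite mulrC -ltr_pdivlMr //; apply: hd => //; lra.
Qed.

End OrbitContinuity.

Section Generator.
Variables (R : realType) (X : completeNormedModType R) (A : operator X) (T : R -> X -> X).
Hypothesis gT : generates A T.

Lemma generator_commutes t x : 0 <= t -> dom A x ->
  dom A (T t x) /\ A (T t x) = T t (A x).
Proof.
move=> t0 dx; have [C0T [domE gen]] := gT.
have ht : h^-1 *: (T h (T t x) - T t x) @[h --> 0^'+] --> T t (A x).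
  have [M M0 hM] := continuous_linear_bound (sg_linear C0T t0) (sg_continuous C0T t0).
  apply/cvg_rightP => e e0.
  have [d d0 hd] := (cvg_rightP _ _).1 (gen x dx) (e / M) (divr_gt0 e0 M0).
  exists d => // h h0 hhd.
  have lT := sg_linear C0T t0.
  rewrite -(sg_add C0T _ (ltW h0) t0) (addrC h) (sg_add C0T _ t0 (ltW h0)).
  rewrite -(linear_mapB lT) -(linear_mapZ lT) -(linear_mapB lT).
  apply: (le_lt_trans (hM _)); rewrite mulrC -ltr_pdivlMr //; exact: hd.
have dT : dom A (T t x) by rewrite domE; apply/cvg_ex; exists (T t (A x)).
split => //; apply: (cvg_unique _ (gen _ dT) ht); exact: norm_hausdorff.
Qed.

Lemma generator_expand (N : X -> R) x (e : R) : equivalent_norm N -> dom A x -> 0 < e ->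
  exists2 d : R, 0 < d & forall h, 0 < h -> h < d ->
    N (h^-1 *: (T h x - h *: A (T h x) - x)) < e.
Proof.
move=> eN dx e0; have [C0T [_ gen]] := gT.
have e2 : 0 < e / 2 by rewrite divr_gt0.
have [d1 d10 h1] := (cvg_right_eqnormP eN _ _).1 (gen x dx) _ e2.
have cAx : T h (A x) @[h --> 0^'+] --> A x by case: C0T => _ _ _; exact.
have [d2 d20 h2] := (cvg_right_eqnormP eN _ _).1 cAx _ e2.
exists (Num.min d1 d2); first by rewrite lt_min d10.
move=> h h0; rewrite lt_min => /andP[hd1 hd2].
have -> : h^-1 *: (T h x - h *: A (T h x) - x) =
    (h^-1 *: (T h x - x) - A x) - (T h (A x) - A x).
  rewrite (generator_commutes (ltW h0) dx).2 addrAC (scalerBr _ (T h x - x)) scalerA.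
  by rewrite mulVf ?lt0r_neq0 // scale1r opprB addrA subrK.
have := eqnormB eN (h^-1 *: (T h x - x) - A x) (T h (A x) - A x).
by have := h1 h h0 hd1; have := h2 h h0 hd2; lra.
Qed.

Variables (K : set X) (z : X).
Hypotheses (sK : solid_cone K z) (lA : linear_operator A) (dA : dense (dom A)).
Hypothesis resA : exists w, forall l, w < l -> pos_resolvent K A l.
Hypotheses (dz : dom A z).

(** Along an orbit started in the domain, the implicit Euler step
    [T h x = (1 - h A)^-1 (x + o(h))] preserves the lower bound [- r z] up to
    [o(h)], since [z] is a supersolution. *)
Lemma lower_bound_invariant_dom r x t : K (- A z) -> dom A x ->
  0 <= r -> K (r *: z + x) -> 0 <= t -> K (r *: z + T t x).
Proof.
move=> Kz dx r0 Kx t0; have [C0T [_ gen]] := gT.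
suff H eps : 0 < eps -> K ((r + eps * t) *: z + T t x).
  apply: (cone_unit_small sK) => e e0.
  have t1 : 0 < t + 1 by rewrite ltr_wpDl.
  have := H (e / (t + 1)) (divr_gt0 e0 t1); set q := _ * t => Hq.
  have qe : q <= e by rewrite /q mulrAC ler_pdivrMr // ler_pM2l //; lra.
  have -> : r *: z + T t x + e *: z = (e - q) *: z + ((r + q) *: z + T t x).
    by rewrite addrA -scalerDl addrAC -scalerDl; congr (_ *: _ + _); ring.
  apply: (coneD sK) => //; apply: (coneZ sK); last exact: cone_unit sK.
  by rewrite subr_ge0.
move=> e0.
(* The error made by the Euler steps accumulates at most at the rate [eps]. *)
pose Q (a b : R) := a <= b /\ forall rho, 0 <= rho -> K (rho *: z + T a x) ->
  K ((rho + eps * (b - a)) *: z + T b x).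
suff [_ /(_ r r0)] : Q 0 t by rewrite subr0 (sg0 C0T); exact.
apply: real_induction => //.
- move=> a b c [ab Qab] [bc Qbc]; split; first exact: le_trans bc.
  move=> rho rho0 h.
  have -> : rho + eps * (c - a) = rho + eps * (b - a) + eps * (c - b) by ring.
  apply: Qbc; last exact: Qab.
  by rewrite addr_ge0 // mulr_ge0 ?subr_ge0 // ltW.
- by split=> // rho rho0; rewrite subrr mulr0 addr0.
- move=> s s0 st hs; split; first exact: ltW.
  move=> rho rho0 h; apply: (cone_lim sK) => e e1.
  have e2 : 0 < e / 2 by rewrite divr_gt0.
  have [d d0 hd] := sg_left_continuous C0T x s e2.
  pose D := eps * (`|z| + 1).
  have D0 : 0 < D by rewrite mulr_gt0 // ltr_wpDl.
  have m0 : 0 < Num.min d (e / 2 / D) by rewrite lt_min d0 divr_gt0.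
  have [s' /andP[ss' s's] [s'0 Qs']] := hs _ m0.
  have [sd sD] : s - d < s' /\ s - s' < e / 2 / D.
    by split; move: ss'; rewrite ltrBlDr -ltrBlDl lt_min => /andP[]; lra.
  exists ((rho + eps * (s' - 0)) *: z + T s' x); first exact: Qs'.
  rewrite opprD addrACA -scalerBl !subr0.
  have -> : rho + eps * s' - (rho + eps * s) = - (eps * (s - s')) by ring.
  apply: (le_lt_trans (ler_normD _ _)); rewrite normrZ normrN.
  have ss'0 : 0 <= s - s' by rewrite subr_ge0.
  rewrite ger0_norm; last by rewrite mulr_ge0 // ltW.
  have h1 := hd s' s'0 sd s's.
  have h2 : (s - s') * D < e / 2 by rewrite -ltr_pdivlMr.
  have h3 : 0 <= eps * (s - s') by rewrite mulr_ge0 // ltW.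
  rewrite /D in h2; nra.
- move=> s s0 st.
  have [w hw] := resA.
  have [dTs ATs] := generator_commutes s0 dx.
  have [d d0 hd] := generator_expand (gauge_equivalent sK) dTs e0.
  pose d' := Num.min d (`|w| + 1)^-1.
  exists d'; first by rewrite lt_min d0 invr_gt0 ltr_wpDl.
  move=> h h0; rewrite lt_min => /andP[hhd hw'].
  split; first by rewrite lerDl ltW.
  move=> rho rho0 hrho; rewrite addrAC subrr add0r.
  have wh : w < h^-1.
    apply: (@lt_trans _ _ (`|w| + 1)); first by have := ler_norm w; lra.
    by rewrite -[X in X < _]invrK ltf_pV2 ?posrE // invr_gt0 ltr_wpDl.
  have [_ pos] := hw _ wh.
  rewrite (addrC s) (sg_add C0T _ (ltW h0) s0); set v := T s x in dTs hd hrho *.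
  have [dTv _] := generator_commutes (ltW h0) dTs.
  apply: pos; first exact: (domZD lA).
  rewrite (shifted_ZD lA) //.
  set q := h^-1 *: (T h v - h *: A (T h v) - v).
  have -> : h^-1 *: T h v - A (T h v) = h^-1 *: v + q.
    rewrite /q [in RHS]scalerBr addrCA subrr addr0 scalerBr scalerA.
    by rewrite mulVf ?lt0r_neq0 // scale1r.
  have -> : (rho + eps * h) *: (h^-1 *: z - A z) + (h^-1 *: v + q) =
     (rho + eps * h) *: (- A z) + (h^-1 *: (rho *: z + v) + (eps *: z + q)).
    have -> : (rho + eps * h) *: (h^-1 *: z - A z) =
        (rho + eps * h) *: (- A z) + ((h^-1 * rho) *: z + eps *: z).
      rewrite scalerDr addrC scalerA -scalerDl; congr (_ + _ *: _).
      by rewrite mulrDl mulfK ?lt0r_neq0 // mulrC.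
    by rewrite -addrA addrACA (scalerDr h^-1) scalerA.
  have qe : gauge K z q <= eps by apply: ltW; exact: hd.
  apply: (coneD sK); first by apply: (coneZ sK) => //; rewrite addr_ge0 // mulr_ge0 // ltW.
  apply: (coneD sK); first by apply: (coneZ sK) => //; rewrite invr_ge0 ltW.
  by case: (gauge_bound sK qe).
Qed.

Lemma lower_bound_invariant r x t : K (- A z) ->
  0 <= r -> K (r *: z + x) -> 0 <= t -> K (r *: z + T t x).
Proof.
move=> Kz r0 Kx t0; have [C0T _] := gT; have eN := gauge_equivalent sK.
have [M M0 hM] := continuous_linear_bound (sg_linear C0T t0) (sg_continuous C0T t0).
apply: (cone_lim sK) => e e0; pose e1 := e / 2 / (`|z| + 1).
have z1 : 0 < `|z| + 1 by rewrite ltr_wpDl.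
have e10 : 0 < e1 by rewrite !divr_gt0.
have [d d0 hd] := eqnorm_small eN e10.
have m0 : 0 < Num.min d (e / 2 / M) by rewrite lt_min d0 !divr_gt0.
have [y dy] := dense_ball x dA m0; rewrite lt_min => /andP[/hd xy1 xy2].
exists ((r + e1) *: z + T t y).
  apply: lower_bound_invariant_dom => //; first by rewrite addr_ge0 // ltW.
  have -> : (r + e1) *: z + y = (r *: z + x) + (e1 *: z + (y - x)).
    by rewrite addrACA -scalerDl (addrC x) subrK.
  apply: (coneD sK) => //; rewrite -(opprB x y).
  by case: (gauge_bound sK (ltW xy1)).
rewrite opprD addrACA -scalerBl addrAC subrr add0r -(linear_mapB (sg_linear C0T t0)).
apply: (le_lt_trans (ler_normD _ _)); rewrite normrZ gtr0_norm //.
have h1 : e1 * `|z| < e / 2.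
  by rewrite /e1 mulrAC ltr_pdivrMr // ltr_pM2l ?divr_gt0 //; lra.
have h2 : `|T t (y - x)| < e / 2.
  by apply: (le_lt_trans (hM _)); rewrite mulrC -ltr_pdivlMr // distrC.
lra.
Qed.

End Generator.

Section Growth.
Variables (R : realType) (X : completeNormedModType R) (A : operator X) (T : R -> X -> X).
Variables (K : set X) (z : X).
Hypothesis gT : generates A T.
Hypotheses (sK : solid_cone K z) (lA : linear_operator A) (dA : dense (dom A)).
Hypothesis resA : exists w, forall l, w < l -> pos_resolvent K A l.
Hypotheses (dz : dom A z).
Variable c : R.
Hypothesis hc : K (c *: z - A z).

(** The semigroup [e^(- c t) T t] has the generator [A - c], for which [z] is a
    supersolution. *)
Lemma orbit_lower_bound r x t : 0 <= r -> K (r *: z + x) -> 0 <= t ->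
  K ((r * expR (c * t)) *: z + T t x).
Proof.
move=> r0 Kx t0.
pose A' := shift_operator A c; have lA' := shift_linear c lA : linear_operator A'.
have gT' : generates A' (fun t x => expR (- c * t) *: T t x).
  by apply: rescaled_generates; rewrite shift_operatorK.
have resA' : exists w, forall l, w < l -> pos_resolvent K A' l.
  have [w hw] := resA; exists (w - c) => l wl.
  have wl' : w < l + c by lra.
  have [surj pos] := hw _ wl'.
  have E y : l *: y - A' y = (l + c) *: y - A y.
    by rewrite /= opprB addrA scalerDl.
  split; first by move=> y; have [v dv vy] := surj y; exists v; rewrite ?E.
  by move=> y dy; rewrite E; exact: pos.
have Kz : K (- A' z) by rewrite /= opprB.
have := lower_bound_invariant gT' sK lA' dA resA' dz Kz r0 Kx t0.
have p : 0 < expR (c * t) by exact: expR_gt0.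
move=> /(coneZ sK (ltW p)); rewrite scalerDr !scalerA -expRD mulrC.
by rewrite mulNr subrr expR0 scale1r.
Qed.

Lemma generated_positive : positive_semigroup K T.
Proof.
move=> t t0 x Kx; have := @orbit_lower_bound 0 x t (lexx 0).
by rewrite mul0r !scale0r !add0r; apply.
Qed.

Lemma gauge_growth t x : 0 <= t -> gauge K z (T t x) <= expR (c * t) * gauge K z x.
Proof.
move=> t0; have lT := sg_linear (proj1 gT) t0.
have N0 := gauge_ge0 sK x.
have [x1 x2] := gauge_bound sK (lexx (gauge K z x)).
apply: gauge_le; first by rewrite mulr_ge0 // expR_ge0.
split; rewrite mulrC; last exact: orbit_lower_bound.
have := orbit_lower_bound N0 x1 t0.
by rewrite -scaleN1r (linear_mapZ lT) scaleN1r.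
Qed.

Lemma growth_bound_le : (growth_bound T <= c%:E)%E.
Proof.
have eN := gauge_equivalent sK.
have [a a0 ha] := eqnorm_upper eN; have [b b0 hb] := eqnorm_lower eN.
apply: ereal_inf_lbound; exists c => //.
exists (Num.max 1 (b * a)); first by rewrite le_max lexx.
move=> t t0; apply: ge_ereal_sup => _ [x /= x1 <-]; rewrite lee_fin.
have h : `|T t x| <= b * a * expR (t * c).
  apply: (le_trans (hb _)); rewrite -mulrA ler_pM2l // mulrC (mulrC t).
  apply: (le_trans (gauge_growth x t0)); rewrite ler_pM2l ?expR_gt0 //.
  by apply: (le_trans (ha x)); rewrite ler_piMr // ltW.
by apply: (le_trans h); rewrite ler_pM2r ?expR_gt0 // le_max lexx orbT.
Qed.

End Growth.

(** * Positive functionals and the dual operator *)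
Section Duality.
Variables (R : realType) (X : completeNormedModType R) (A : operator X).
Variables (K : set X) (u : X).
Hypotheses (sK : solid_cone K u) (lA : linear_operator A) (dA : dense (dom A)).

Lemma dom_interior : exists2 z, interior K z & dom A z.
Proof.
have [|z [zK zA]] := dA (_ : interior K !=set0) (open_interior K); last by exists z.
by exists u; case: sK.
Qed.

(** Let [E] be the cone of the pairs [(A x + k1, x - k2)] in [X * X], with [k1] and [k2]
    in [K].  If [A] maps no interior point strictly below [0], then [E] stays away from
    [(- u, 0)], so that some functional [H] is nonnegative on [E] and positive at
    [(u, 0)].  Its components are [f] and [- g]; it vanishes on the graph of [A], which
    says that [g] is the image of [f] under the dual operator. *)
Lemma positive_dual_pair :
  ~ (exists z, [/\ interior K z, dom A z & cone_ll K (A z) 0]) ->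
  exists f g : X -> R, [/\ dual_cone K f, dual_cone K g, f <> 0 &
    forall x, dom A x -> f (A x) = g x].
Proof.
move=> nv.
pose E (w : X * X) := exists x k1 k2, [/\ dom A x, K k1, K k2 & w = (A x + k1, x - k2)].
pose n (w : X * X) := `|w.1| + `|w.2|.
have nD v w : n (v + w) <= n v + n w.
  by rewrite /n addrACA; apply: lerD; exact: ler_normD.
have nZ (a : R) w : 0 <= a -> n (a *: w) = a * n w.
  by move=> a0; rewrite /n !normrZ ger0_norm // mulrDr.
have n0 w : 0 <= n w by rewrite addr_ge0.
have K0 := cone0 sK.
have E0 : E 0.
  by exists 0, 0, 0; split => //; [exact: dom0|rewrite (op0 lA) subrr addr0].
have ED v w : E v -> E w -> E (v + w).
  move=> [x [k1 [k2 [dx h1 h2 ->]]]] [y [l1 [l2 [dy h3 h4 ->]]]].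
  exists (x + y), (k1 + l1), (k2 + l2); split.
  - exact: (domD lA).
  - exact: (coneD sK).
  - exact: (coneD sK).
  - by rewrite [LHS]surjective_pairing /= (opD lA) // opprD addrACA (addrACA x).
have EZ (a : R) w : 0 <= a -> E w -> E (a *: w).
  move=> a0 [x [k1 [k2 [dx h1 h2 ->]]]].
  exists (a *: x), (a *: k1), (a *: k2); split.
  - exact: (domZ lA).
  - exact: (coneZ sK).
  - exact: (coneZ sK).
  - by rewrite [LHS]surjective_pairing /= (opZ lA) // scalerDr scalerBr.
pose S w := [set n (w + y) | y in E].
(* The distance from [- w] to [E]. *)
pose p w := inf (S w).
have ple w y : E y -> p w <= n (w + y).
  by move=> Ey; apply: ge_inf; [exists 0 => _ [y' _ <-]|exists y].
have pge w m : (forall y, E y -> m <= n (w + y)) -> m <= p w.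
  move=> h; apply: lb_le_inf; first by exists (n (w + 0)); exists 0.
  by move=> _ [y Ey <-]; exact: h.
have sp : sublinear p.
  apply: sublinearP.
  - move=> v w; rewrite -lerBlDr; apply: (pge) => y Ey.
    rewrite lerBlDr -lerBlDl; apply: (pge) => y' Ey'; rewrite lerBlDl.
    by apply: (le_trans (ple _ _ (ED _ _ Ey Ey'))); rewrite addrACA.
  - apply/le_anti/andP; split; last by apply: pge => y _.
    by apply: (le_trans (ple _ _ E0)); rewrite addr0 /n !normr0 addr0.
  - move=> a w a0; rewrite -ler_pdivrMl //; apply: (pge) => y Ey.
    rewrite ler_pdivrMl // -(nZ _ _ (ltW a0)) scalerDr.
    by apply: ple; apply: EZ => //; exact: ltW.
have [H [lH Hp He]] := hahn_banach (u, 0) sp.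
have HD v w : H (v + w) = H v + H w by have := lH 1 v w; rewrite !scale1r.
have HN v : H (- v) = - H v.
  by have := linear_mapB lH 0 v; rewrite sub0r (linear_map0 lH) sub0r.
have Hn v : H v <= n v by apply: (le_trans (Hp v)); have := ple v 0 E0; rewrite addr0.
have HE y : E y -> 0 <= H y.
  move=> Ey; rewrite -oppr_le0 -HN; apply: (le_trans (Hp _)).
  by apply: (le_trans (ple _ _ Ey)); rewrite addNr /n !normr0 addr0.
have Hc v : `|H v| <= n v.
  rewrite ler_norml Hn andbT lerNl -HN; apply: (le_trans (Hn _)).
  by rewrite /n !normrN.
pose f (x : X) : R := H (x, 0); pose g (x : X) : R := - H (0, x).
have df : dual_space f.
  have lf : linear (f : X -> R^o).
    move=> a x y; rewrite /f -lH; congr H.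
    by rewrite [RHS]surjective_pairing /= scaler0 addr0.
  split=> //; apply: (linear_bound_continuous lf (M := 1)) => x.
  by rewrite mul1r; apply: (le_trans (Hc _)); rewrite /n normr0 addr0.
have dg : dual_space g.
  have lg : linear (g : X -> R^o).
    move=> a x y; rewrite /g scalerN -opprD -lH; congr (- H _).
    by rewrite [RHS]surjective_pairing /= scaler0 addr0.
  split=> //; apply: (linear_bound_continuous lg (M := 1)) => x.
  by rewrite mul1r normrN; apply: (le_trans (Hc _)); rewrite /n normr0 add0r.
have d0 := dom0 lA.
exists f, g; split.
- split=> // k Kk; apply: HE; exists 0, k, 0; split=> //.
  by rewrite (op0 lA) add0r subr0.
- split=> // k Kk; rewrite /g -HN; apply: HE; exists 0, 0, k; split => //.
  by rewrite (op0 lA) addr0 sub0r [LHS]surjective_pairing /= oppr0.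
- move=> f0.
  have [z0 iz0 dz0] := dom_interior.
  have [e0 e00 he0] := interior_dominates u iz0.
  have [c c0 hc] := order_unit sK.
  (* If [E] met the ball of radius [D^-1] around [(- u, 0)] in the pair given by [x],
     then [x + s z0] would be an interior point mapped below [- u / 4]: the term [s z0]
     with [s = 2 c / (D e0)] makes up for [x >= - (c / D) u], and [D] is chosen so that
     [c / D + s c |A z0| = 1 / 2]. *)
  pose D := 2 * c * (1 + 2 * c * `|A z0| / e0).
  have D0 : 0 < D.
    by rewrite !mulr_gt0 // ltr_pwDl // divr_ge0 ?mulr_ge0 // ltW.
  have : D^-1 <= p (u, 0); last first.
    by rewrite -He -/(f u) f0 /= invr_le0 leNgt D0.
  apply: pge => _ [x [k1 [k2 [dx Kk1 Kk2 ->]]]].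
  rewrite leNgt; apply/negP; rewrite /n /= add0r => small; apply: nv.
  set a : X := u + (A x + k1) in small; set b : X := x - k2 in small.
  have na : `|a| < D^-1 by have := normr_ge0 b; lra.
  have nb : `|b| < D^-1 by have := normr_ge0 a; lra.
  have Dc : c * D^-1 <= 2^-1.
    rewrite ler_pdivrMr // /D mulrA mulrA mulVf ?mul1r // ler_peMr ?(ltW c0) //.
    by rewrite lerDl divr_ge0 ?mulr_ge0 // ltW.
  pose s := 2 * c * D^-1 / e0.
  have s0 : 0 < s by rewrite divr_gt0 // mulr_gt0 ?invr_gt0 // mulr_gt0.
  have Ku := cone_unit sK.
  have unitD (t t' : R) w : t <= t' -> K (t *: u + w) -> K (t' *: u + w).
    move=> tt' h; rewrite -(subrK t t') scalerDl -addrA; apply: (coneD sK) => //.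
    by apply: (coneZ sK) => //; rewrite subr_ge0.
  have Ka : K ((c * D^-1) *: u - a).
    apply: unitD (hc (- a)); rewrite normrN ler_pM2l //; exact: ltW.
  have Kb : K ((c * D^-1) *: u + b).
    by apply: unitD (hc b); rewrite ler_pM2l //; exact: ltW.
  have KA : K ((s * (c * `|A z0|)) *: u - s *: A z0).
    rewrite -scalerA -scalerBr; apply: (coneZ sK); first exact: ltW.
    by rewrite -normrN; exact: hc.
  exists (x + s *: z0); split.
  - apply: (@dominates_interior _ _ _ _ sK _ (c * D^-1)); first by rewrite mulr_gt0 ?invr_gt0.
    have -> : x + s *: z0 - (c * D^-1) *: u =
        k2 + ((c * D^-1) *: u + b) + s *: (z0 - e0 *: u).
      rewrite /b scalerBr scalerA.
      have -> : s * e0 = c * D^-1 + c * D^-1 by rewrite /s mulfVK ?lt0r_neq0 //; ring.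
      by rewrite scalerDl; exact: dominated_split.
    apply: (coneD sK); first exact: (coneD sK).
    by apply: (coneZ sK); [exact: ltW|].
  - by apply: (domD lA) => //; exact: (domZ lA).
  - exists (4^-1 *: u).
      apply: (@dominates_interior _ _ _ _ sK _ 4^-1) => //.
      by rewrite subrr; exact: K0.
    rewrite /cone_le sub0r (opD lA) ?(opZ lA) //; last exact: (domZ lA).
    have -> : - (A x + s *: A z0 + 4^-1 *: u) =
        (1 - c * D^-1 - s * (c * `|A z0|) - 4^-1) *: u + k1 +
        (((c * D^-1) *: u - a) + ((s * (c * `|A z0|)) *: u - s *: A z0)).
      by rewrite !scalerBl scale1r; exact: supersolution_split.
    apply: (coneD sK); last exact: (coneD sK).
    apply: (coneD sK) => //; apply: (coneZ sK) => //.
    have E1 : c * D^-1 + s * (c * `|A z0|) = 2^-1.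
      have -> : c * D^-1 + s * (c * `|A z0|) = (2 * c * (1 + 2 * c * `|A z0| / e0)) * D^-1 / 2.
        by rewrite /s; field; rewrite !lt0r_neq0.
      by rewrite -/D mulfV ?lt0r_neq0 // mul1r.
    lra.
- move=> x dx.
  have h1 : 0 <= H (A x, x).
    by apply: HE; exists x, 0, 0; split => //; rewrite addr0 subr0.
  have h2 : 0 <= H (- A x, - x).
    apply: HE; exists (- x), 0, 0; split => //; first exact: (domN lA).
    by rewrite addr0 subr0 (opN lA).
  have E1 : H (A x, x) = f (A x) - g x.
    by rewrite /f /g opprK -HD; congr H; rewrite [RHS]surjective_pairing /= addr0 add0r.
  have E2 : H (- A x, - x) = - H (A x, x) by rewrite -HN; congr H.
  by apply/eqP; rewrite -subr_eq0 -E1; apply/eqP/le_anti; rewrite h1 -oppr_ge0 -E2 h2.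
Qed.

End Duality.

(** * Stability *)
Section Stability.
Variables (R : realType) (X : completeNormedModType R) (A : operator X) (T : R -> X -> X).
Variables (K : set X).

Lemma growth_bound_lt0_cvg : C0_semigroup T -> (growth_bound T < 0)%E ->
  forall x, T t x @[t --> +oo] --> (0 : X).
Proof.
move=> C0T /ereal_inf_lt[_ [om [M M1 hM] <-]]; rewrite lte_fin => om0 x.
have M0 : 0 < M by exact: lt_le_trans M1.
have bnd t : 0 <= t -> `|T t x| <= M * expR (t * om) * `|x|.
  move=> t0; have [->|x0] := eqVneq x 0.
    by rewrite (linear_map0 (sg_linear C0T t0)) !normr0 mulr0.
  rewrite -ler_pdivrMr ?normr_gt0 // mulrC -[X in X * _]ger0_norm ?invr_ge0 //.
  rewrite -normrZ -(linear_mapZ (sg_linear C0T t0)) -lee_fin.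
  apply: le_trans (hM t t0); apply: ereal_sup_ubound.
  by exists (`|x|^-1 *: x) => //=; rewrite normrZ normfV normr_id mulVf // normr_eq0.
apply/cvg_pinftyP => e e0.
exists (M * `|x| / (e * - om)) => t ht.
have D0 : 0 < e * - om by rewrite mulr_gt0 // oppr_gt0.
have t0 : 0 <= t.
  by apply: ltW; apply: le_lt_trans ht; rewrite divr_ge0 ?(ltW D0) // mulr_ge0 // ltW.
rewrite subr0; apply: (le_lt_trans (bnd t t0)).
have h1 : 1 - t * om <= expR (- (t * om)) := expR_ge1Dx _.
have tom : 0 <= - (t * om) by rewrite -mulrN mulr_ge0 // oppr_ge0 ltW.
(* This decay of order [1 / t] is enough. *)
have h2 : expR (t * om) * (1 - t * om) <= 1.
  by have := ler_wpM2l (expR_ge0 (t * om)) h1; rewrite -expRD subrr expR0.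
have h3 : 0 < 1 - t * om by lra.
rewrite -(ltr_pM2r h3); have Mx : 0 <= M * `|x| by rewrite mulr_ge0 // ltW.
have -> : M * expR (t * om) * `|x| * (1 - t * om) =
  (M * `|x|) * (expR (t * om) * (1 - t * om)) by ring.
apply: (@le_lt_trans _ _ (M * `|x|)); first by rewrite ler_piMr.
move: ht; rewrite ltr_pdivrMr // => ht; apply: (lt_trans ht).
by rewrite -subr_gt0; have -> : e * (1 - t * om) - t * (e * - om) = e by ring.
Qed.

Lemma cvg_inf0 x : T t x @[t --> +oo] --> (0 : X) ->
  inf [set `|T t x| | t in [set t : R | 0 <= t]] = 0.
Proof.
move=> /cvg_pinftyP h; set S := [set _ | _ in _].
have lb : lbound S 0 by move=> _ [t _ <-].
apply/le_anti/andP; split; last first.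
  by apply: lb_le_inf => //; exists `|T 0 x|; exists 0 => /=.
apply/ler_addgt0Pr => e e0; have [M hM] := h e e0; rewrite add0r.
pose t := Num.max 0 M + 1; have Mt : M < t by rewrite ltr_pwDr // le_max lexx orbT.
apply: (@le_trans _ _ `|T t x|); last by have := hM t Mt; rewrite subr0 => /ltW.
apply: ge_inf; first by exists 0.
by exists t => //=; rewrite addr_ge0 // le_max lexx.
Qed.

Variable u : X.
Hypotheses (sK : solid_cone K u) (lA : linear_operator A) (dA : dense (dom A)).
Hypothesis gT : generates A T.

(** Along positive orbits a positive functional [f] with [A' f >= 0] does not
    decrease, so it vanishes on orbits that come close to [0]. *)
Lemma dual_pair_vanishes (f g : X -> R) : positive_semigroup K T ->
  dual_cone K f -> dual_cone K g -> (forall x, dom A x -> f (A x) = g x) ->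
  (forall x, K x -> inf [set `|T t x| | t in [set t : R | 0 <= t]] = 0) ->
  f = 0.
Proof.
move=> pT [[lf cf] fK] [_ gK] fg hinf; have [C0T [_ gen]] := gT.
have [M M0 hM] := continuous_linear_bound lf cf.
have fB x y : f (x - y) = f x - f y by exact: (linear_mapB lf).
have fZ a x : f (a *: x) = a * f x by exact: (linear_mapZ lf).
have fN x : f (- x) = - f x by rewrite -scaleN1r fZ mulN1r.
have incr x t : dom A x -> K x -> 0 <= t -> f x <= f (T t x).
  move=> dx Kx t0; apply/ler_addgt0Pr => e e0.
  have t1 : 0 < t + 1 by rewrite ltr_wpDl.
  pose eps := e / (t + 1); have eps0 : 0 < eps by rewrite divr_gt0.
  pose Q (a b : R) := a <= b /\ f (T a x) <= f (T b x) + eps * (b - a).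
  suff [_] : Q 0 t.
    rewrite subr0 (sg0 C0T) => /le_trans; apply; rewrite lerD2l /eps mulrAC.
    by rewrite ler_pdivrMr // ler_pM2l //; lra.
  apply: real_induction => //.
  - move=> a b c [ab h1] [bc h2]; split; first exact: le_trans bc.
    by lra.
  - by split; rewrite // subrr mulr0 addr0.
  - move=> s s0 st hs; split; first exact: ltW.
    apply/ler_addgt0Pr => d d0.
    have [d1 d10 hd1] := sg_left_continuous C0T x s (divr_gt0 d0 M0).
    have [s' /andP[ss' s's] [s'0 Qs']] := hs d1 d10.
    have h1 := hd1 s' s'0 ss' s's; rewrite ltr_pdivlMr // in h1.
    have h2 : f (T s' x) - f (T s x) <= d.
      rewrite -fB; apply: (le_trans (ler_norm _)); apply: (le_trans (hM _)).
      by rewrite mulrC ltW.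
    have h3 : eps * s' <= eps * s by rewrite ler_pM2l.
    by lra.
  - move=> s s0 st; have [ds As] := generator_commutes gT s0 dx.
    have [d d0 hd] := (cvg_rightP _ _).1 (gen _ ds) _ (divr_gt0 eps0 M0).
    exists d => // h h0 hhd; split; first by rewrite lerDl ltW.
    have := hd h h0 hhd; rewrite ltr_pdivlMr // mulrC => h1.
    have h2 := le_trans (hM _) (ltW h1); rewrite ler_norml in h2.
    rewrite -(sg_add C0T _ (ltW h0) s0) (addrC h) fB fZ fB fg // in h2.
    have h3 : 0 <= g (T s x) by apply: gK; exact: pT.
    move/andP : h2 => [h2 _].
    have : - eps <= h^-1 * (f (T (s + h) x) - f (T s x)) by lra.
    by rewrite ler_pdivlMl //; lra.
have fle x : dom A x -> K x -> f x <= 0.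
  move=> dx Kx; rewrite -(mulr0 M) -(hinf x Kx) -ler_pdivrMl //.
  apply: lb_le_inf; first by exists `|T 0 x|; exists 0 => /=.
  move=> _ [t /= t0 <-]; rewrite ler_pdivrMl //.
  by apply: le_trans (incr x t dx Kx t0) _; apply: le_trans (ler_norm _) (hM _).
have [z iz dz] := dom_interior sK dA.
have sKz := solid_cone_interior sK iz.
have fz : f z = 0.
  by apply/le_anti; rewrite fle ?fK //=; exact: interior_subset iz.
have [c c0 hc] := order_unit sKz.
have f0 y : 0 <= f y.
  have := fK _ (hc y).
  have -> : f ((c * `|y|) *: z + y) = f y by rewrite lf fz scaler0 add0r.
  by [].
apply/funext => y; apply/le_anti; rewrite f0 andbT -oppr_ge0 -fN.
exact: f0.
Qed.

(** Applying [- A^-1] to [- A x <= eta |x| z] gives [x <= eta |x| x0] with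
    [x0 = - A^-1 z], which for small [eta] contradicts normality. *)
Lemma inverse_not_supersolution (z : X) : pos_resolvent K A 0 -> interior K z ->
  exists2 eta : R, 0 < eta & forall x, x <> 0 -> dom A x -> K x ->
    ~ cone_le K (- (eta * `|x|) *: z) (A x).
Proof.
move=> [surj pos] iz; have [x0 d0] := surj z; rewrite scale0r sub0r => e0.
have [_ _ [C C0 hC] _] := sK.
have D0 : 0 < C * `|x0| + 1 by rewrite ltr_wpDl // mulr_ge0 // ltW.
exists (C * `|x0| + 1)^-1; first by rewrite invr_gt0.
move=> x x_neq0 dx Kx; rewrite /cone_le scaleNr opprK => h.
set eta := (_ + 1)^-1 in h; have nx : 0 < `|x| by rewrite normr_gt0; exact/eqP.
have : K ((eta * `|x|) *: x0 - x).
  apply: pos; first by apply: (domB lA) => //; exact: (domZ lA).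
  rewrite scale0r sub0r (opB lA) ?(opZ lA) //; last exact: (domZ lA).
  by rewrite opprB -scalerN e0.
have K0x : cone_le K 0 x by rewrite /cone_le subr0.
move=> /(hC x _ K0x); rewrite normrZ ger0_norm; last by rewrite mulr_ge0 ?invr_ge0 // ltW.
apply/negP; rewrite -ltNge.
have -> : C * (eta * `|x| * `|x0|) = (C * `|x0|) * eta * `|x| by ring.
by rewrite gtr_pMl // /eta ltr_pdivrMr // mul1r ltrDl.
Qed.

(** The image [x] of [z] under the resolvent at some [l >= 0] has [A x = l x - z >= - z].
    The hypothesis therefore bounds its norm by [1 / eta], uniformly in [l], which
    [not_pos_resolvent0] excludes if [0] is not a point of positive resolvent. *)
Lemma not_supersolution_pos_resolvent (z : X) (eta : R) : interior K z ->
  (exists w, forall l, w < l -> pos_resolvent K A l) -> 0 < eta ->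
  (forall x, x <> 0 -> dom A x -> K x -> ~ cone_le K (- (eta * `|x|) *: z) (A x)) ->
  pos_resolvent K A 0.
Proof.
move=> iz resA eta0 h.
have sKz := solid_cone_interior sK iz.
have [//|n0] := pselect (pos_resolvent K A 0); exfalso.
have [l0 l00 hl] := not_pos_resolvent0 sKz lA resA n0.
have [c c0 hc] := order_unit sKz.
have [d d0 hd] := hl (c / eta) (divr_gt0 c0 eta0).
have [||[surj pos] nK] := hd (l0 + d / 2); [lra|lra|].
have [x dx ex] := surj z; apply: (nK x dx ex).
have Kx : K x by apply: pos => //; rewrite ex; exact: cone_unit sKz.
have small : eta * `|x| <= 1.
  rewrite leNgt; apply/negP => big; apply: (h x) => //.
    by move=> x0; move: big; rewrite x0 normr0 mulr0 ltr10.
  have -> : A x = (l0 + d / 2) *: x - z by rewrite -ex opprB addrC subrK.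
  rewrite /cone_le scaleNr opprK addrAC -addrA; apply: (coneD sK).
    by apply: (coneZ sK) => //; rewrite addr_ge0 // divr_ge0 // ltW.
  rewrite -[X in _ - X]scale1r -scalerBl; apply: (coneZ sK); last exact: cone_unit sKz.
  by rewrite subr_ge0 ltW.
have := hc (- x); rewrite normrN => Kc.
rewrite -(subrK (c * `|x|) (c / eta)) scalerDl -addrA; apply: (coneD sK) => //.
apply: (coneZ sK); last exact: cone_unit sKz.
by rewrite subr_ge0 ler_pM2l // -[X in _ <= X]mul1r ler_pdivlMr // mulrC.
Qed.

End Stability.

Section DualOperator.
Variables (R : realType) (X : normedModType R) (A : operator X).

Lemma dual_operatorP f : dom (dual_operator A) f -> dual_graph A f (dual_operator A f).
Proof.
by move=> [g hg]; apply: (@xgetPex _ (0 : X -> R) [set g | dual_graph A f g]); exists g.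
Qed.

Lemma dual_graph_unique f g g' : dense (dom A) ->
  dual_graph A f g -> dual_graph A f g' -> g = g'.
Proof.
move=> dA [_ [lg cg] fg] [_ [lg' cg'] fg']; apply/funext => y.
have [M M0 hM] := continuous_linear_bound lg cg.
have [M' M'0 hM'] := continuous_linear_bound lg' cg'.
have S0 : 0 < M + M' by rewrite addr_gt0.
apply/subr0_eq/normr0_eq0/le_anti; rewrite normr_ge0 andbT.
apply/ler_addgt0Pr => e e0; rewrite add0r.
have [x dx xy] := dense_ball y dA (divr_gt0 e0 S0).
have -> : g y - g' y = g (y - x) - g' (y - x).
  have gx : g x = g' x by rewrite -fg // fg'.
  by rewrite (linear_mapB lg) (linear_mapB lg') gx subrACA subrr subr0.
apply: (le_trans (ler_normB _ _)); apply: (le_trans (lerD (hM _) (hM' _))).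
by rewrite -mulrDl mulrC -ler_pdivlMr // ltW.
Qed.

End DualOperator.

Theorem theorem4p7 (R : realType) (X : completeNormedModType R) (K : set X)
    (A : operator X) :
  ordered_banach K ->
  normal_cone K ->
  interior K !=set0 ->
  linear_operator A ->
  dense (dom A) ->
  resolvent_positive K A ->
  (exists T : R -> X -> X, generates A T) /\
  (forall T : R -> X -> X, generates A T ->
    positive_semigroup K T /\
    [<-> (* (i) *)
         (spectral_bound A < 0)%E;
         (* (ii) *)
         forall x' : X -> R, x' <> 0 -> cone_le (dual_cone K) 0 x' ->
           dom (dual_operator A) x' ->
           ~ cone_le (dual_cone K) 0 (dual_operator A x');
         (* (iii) *)
         forall z : X, interior K z ->
           exists2 eta : R, 0 < eta &
             forall x : X, x <> 0 -> dom A x -> K x ->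
               ~ cone_le K (- (eta * `|x|) *: z) (A x);
         (* (iv) *)
         exists2 z : X, interior K z &
           exists2 eta : R, 0 < eta &
             forall x : X, x <> 0 -> dom A x -> K x ->
               ~ cone_le K (- (eta * `|x|) *: z) (A x);
         (* (v) *)
         exists z : X, [/\ interior K z, dom A z & cone_ll K (A z) 0];
         (* (vi) *)
         exists z : X, [/\ interior K z, dom A z &
           exists2 lambda : R, lambda < 0 & cone_le K (A z) (lambda *: z)];
         (* (vii) *)
         forall x : X, T t x @[t --> +oo] --> (0 : X);
         (* (viii) *)
         forall x : X, K x -> inf [set `|T t x| | t in [set t : R | 0 <= t]] = 0;
         (* (ix) *)
         (growth_bound T < 0)%E]).
Proof.
move=> [ccK properK] normK [u iu] lA dA posA.
have solid z : interior K z -> solid_cone K z.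
  move=> iz; split=> // x Kx KNx.
  have : (K `&` [set - y | y in K]) x by split=> //; exists (- x); rewrite ?opprK.
  by rewrite properK.
have resA : exists w, forall l, w < l -> pos_resolvent K A l.
  have [w hw] := posA; exists w => l /hw[rl pl].
  exact: resolvent_positive_real.
have [z iz dz] := dom_interior (solid u iu) dA.
split; first exact: (pos_resolvent_generates (solid z iz) lA dA dz resA).
move=> T gT; have [c _ hc] := exists_growth_rate A (solid z iz).
have posT := generated_positive gT (solid z iz) lA dA resA dz hc.
split=> //.
have inv_v : pos_resolvent K A 0 ->
    exists z : X, [/\ interior K z, dom A z & cone_ll K (A z) 0].
  move=> p0; have [x0 d0] := p0.1 u; rewrite scale0r sub0r => e0.
  exists x0; split => //; first exact: (inverse_unit_interior (solid u iu) lA dA p0 d0 e0).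
  exists u => //; rewrite /cone_le sub0r -e0 subrr oppr0.
  exact: cone0 (solid u iu).
have v_vi : (exists z : X, [/\ interior K z, dom A z & cone_ll K (A z) 0]) ->
    exists z : X, [/\ interior K z, dom A z &
      exists2 lambda : R, lambda < 0 & cone_le K (A z) (lambda *: z)].
  move=> [y [iy dy [w iw]]]; rewrite /cone_le sub0r => h.
  exists y; split=> //; have [e e0 he] := interior_dominates y iw.
  exists (- e); first by rewrite oppr_lt0.
  have -> : - e *: y - A y = - (A y + w) + (w - e *: y).
    by rewrite opprD addrA subrK addrC scaleNr.
  exact: (coneD (solid u iu)).
have vi_i : (exists z : X, [/\ interior K z, dom A z &
      exists2 lambda : R, lambda < 0 & cone_le K (A z) (lambda *: z)]) ->
    (spectral_bound A < 0)%E.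
  move=> [y [iy dy [l l0 hl]]].
  by apply: le_lt_trans (spectral_bound_le (solid y iy) lA dy hl resA) _; rewrite lte_fin.
have vi_ix : (exists z : X, [/\ interior K z, dom A z &
      exists2 lambda : R, lambda < 0 & cone_le K (A z) (lambda *: z)]) ->
    (growth_bound T < 0)%E.
  move=> [y [iy dy [l l0 hl]]].
  by apply: le_lt_trans (growth_bound_le gT (solid y iy) lA dA resA dy hl) _; rewrite lte_fin.
have i_inv : (spectral_bound A < 0)%E -> pos_resolvent K A 0.
  exact: (spectral_bound_pos_resolvent lA (solid u iu) resA).
have ii_v : (forall x' : X -> R, x' <> 0 -> cone_le (dual_cone K) 0 x' ->
      dom (dual_operator A) x' -> ~ cone_le (dual_cone K) 0 (dual_operator A x')) ->
    exists z : X, [/\ interior K z, dom A z & cone_ll K (A z) 0].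
  move=> h; apply: contrapT => /(positive_dual_pair (solid u iu) lA dA).
  move=> [f [g [fK gK f0 fg]]].
  have dg : dual_graph A f g by split=> //; [case: fK|case: gK].
  have df : dom (dual_operator A) f by exists g.
  apply: (h f) => //; rewrite /cone_le subr0 //.
  by rewrite (dual_graph_unique dA (dual_operatorP df) dg).
have viii_ii : (forall x, K x -> inf [set `|T t x| | t in [set t : R | 0 <= t]] = 0) ->
    forall x' : X -> R, x' <> 0 -> cone_le (dual_cone K) 0 x' ->
      dom (dual_operator A) x' -> ~ cone_le (dual_cone K) 0 (dual_operator A x').
  move=> hinf f f0; rewrite /cone_le !subr0 => fK df gK; apply: f0.
  have [_ _ fg] := dual_operatorP df.
  exact: (dual_pair_vanishes (solid u iu) dA gT posT fK gK fg hinf).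
have ix_vii : (growth_bound T < 0)%E -> forall x : X, T t x @[t --> +oo] --> (0 : X).
  exact: (growth_bound_lt0_cvg gT.1).
have vii_viii : (forall x : X, T t x @[t --> +oo] --> (0 : X)) ->
    forall x, K x -> inf [set `|T t x| | t in [set t : R | 0 <= t]] = 0.
  by move=> h x _; exact: cvg_inf0.
tfae.
- by move=> /i_inv/inv_v/v_vi/vi_ix/ix_vii/vii_viii/viii_ii.
- move=> /ii_v/v_vi/vi_i/i_inv p0 y iy.
  exact: (inverse_not_supersolution (solid u iu) lA p0 iy).
- by move=> h; exists u => //; exact: h.
- move=> [y iy [eta eta0 h]]; apply: inv_v.
  exact: (not_supersolution_pos_resolvent (solid u iu) lA iy resA eta0 h).
- exact: v_vi.
- by move=> /vi_ix/ix_vii.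
- exact: vii_viii.
- by move=> /viii_ii/ii_v/v_vi/vi_ix.
- by move=> /ix_vii/vii_viii/viii_ii/ii_v/v_vi/vi_i.
Qed.
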